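(* Let $\mathbb{F}_q$ be a finite field of characteristic $p$, and let $x = \sum_{i \in I} x_i t^i$ be a generalized power series over $\mathbb{F}_q$ whose support is contained in $\mathbb{Z}[\frac{1}{p}]$. Then $x$ is algebraic over $\mathbb{F}_q[t]$ if and only if $x$ is automatic.
   Context: Generalized power series: a generalized power series over $\mathbb{F}_q$ is a formal sum $x = \sum_{i \in I} x_i t^i$ with $x_i \in \mathbb{F}_q$, where $I$ is a well-ordered subset of the nonnegative rationals (every nonempty subset of $I$ has a least element); put $x_i = 0$ for $i \notin I$. The support of $x$ is the set of $i$ with $x_i \neq 0$. With termwise addition and the convolution product these series form a ring, denoted $\mathbb{F}_q[[ t^{\mathbb{Q}} ]]$, which contains $\mathbb{F}_q[t]$ and $\mathbb{F}_q[[t]]$. An element $x$ is algebraic over a subring $R$ if it is a root of a nonzero polynomial with coefficients in $R$. Finite automaton: a tuple $(\Sigma, O, S, s_0, f, T)$ where $\Sigma$ (input alphabet), $O$ (output set) and $S$ (state space) are finite sets, $s_0 \in S$ is the initial state, $f: S \to O$ is the output map, and $T: \Sigma \times S \to S$ is the transition map. Given a string $\sigma_1 \cdots \sigma_n$ of elements of $\Sigma$, define successively $s_j = T(\sigma_j, s_{j-1})$ for $j = 1, \dots, n$; the output of the automaton on the string is $f(s_n)$. Base $p$ representation: the base $p$ representation of a nonnegative $i \in \mathbb{Z}[\frac{1}{p}]$ is the usual finite string of digits in $\{0, \dots, p-1\}$, with most significant digit first, with a radix point ''.'' separating the integer part from the fractional part (the point being omitted for integers), without superfluous leading or trailing zeros.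 Automatic: a generalized power series $x = \sum_i x_i t^i$ over $\mathbb{F}_q$ is automatic if (a) the support of $x$ is contained in $\mathbb{Z}[\frac{1}{p}]$; and (b) there exists a finite automaton with input alphabet $\{0, \dots, p-1, .\}$ (the $p$ digits together with the radix point) and output set $\mathbb{F}_q$ that, on input the base $p$ representation of any nonnegative $i \in \mathbb{Z}[\frac{1}{p}]$, returns $x_i$. *)

(* Defs.v *)
From HB Require Import structures.
From mathcomp Require Import all_boot all_order all_algebra.
From mathcomp Require Import boolp classical_sets functions cardinality fsbigop.
From mathcomp Require Import finmap.

Set Implicit Arguments.
Unset Strict Implicit.
Unset Printing Implicit Defensive.

Import Order.TTheory GRing.Theory Num.Theory.
Local Open Scope classical_set_scope.
Local Open Scope ring_scope.

Definition well_ordered (I : set rat) : Prop :=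
  forall A : set rat, A `<=` I -> A !=set0 -> exists2 m, A m & lbound A m.

Section WellOrdered.
Implicit Types I J K : set rat.

Lemma well_orderedS I J : J `<=` I -> well_ordered I -> well_ordered J.
Proof. by move=> JI wI A AJ; apply: wI => x /AJ /JI. Qed.

Lemma well_orderedU I J :
  well_ordered I -> well_ordered J -> well_ordered (I `|` J).
Proof.
move=> wI wJ A AIJ [a Aa].
have [AI0|AI0] := pselect ((A `&` I) !=set0); last first.
  apply: wJ; last by exists a.
  by move=> y Ay; case: (AIJ y Ay) => // Iy; case: AI0; exists y.
have [AJ0|AJ0] := pselect ((A `&` J) !=set0); last first.
  apply: wI; last by exists a.
  by move=> y Ay; case: (AIJ y Ay) => // Jy; case: AJ0; exists y.
have [m [Am Im] lm] := wI _ (@subIsetr _ _ _) AI0.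
have [n [An Jn] ln] := wJ _ (@subIsetr _ _ _) AJ0.
exists (Num.min m n); first by case: leP.
move=> y Ay; rewrite ge_min; case: (AIJ y Ay) => Dy; apply/orP; [left|right].
  by apply: lm.
by apply: ln.
Qed.

Definition sumset I J : set rat := [set a + b | a in I & b in J].

Lemma well_ordered_sumset I J :
  well_ordered I -> well_ordered J -> well_ordered (sumset I J).
Proof.
move=> wI wJ C CIJ [c0 Cc0]; apply: contrapT => nomin.
have low c : C c -> exists2 c', C c' & c' < c.
  move=> Cc; apply: contrapT => H; apply: nomin; exists c => // y Cy.
  by rewrite leNgt; apply/negP => yc; apply: H; exists y.
pose good a b := [/\ I a, J b, C (a + b) & forall a' b', I a' -> J b' ->
  C (a' + b') -> a' + b' < a + b -> a < a'].
(* below any element of C, the lexicographically least decomposition is good *)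
have mk (D : set rat) : D `<=` C -> D !=set0 ->
    (forall c c', D c -> C c' -> c' < c -> D c') ->
    exists a b, good a b /\ D (a + b).
  move=> DC [d Dd] Ddown.
  have [||a [Ia [b1 Jb1 Dab1]] la] :=
      wI [set a | I a /\ exists2 b, J b & D (a + b)].
  - by move=> y [].
  - have [a Ia [b Jb abd]] := CIJ _ (DC _ Dd).
    by exists a; split=> //; exists b; rewrite ?abd.
  have [||b [Jb Dab] lb] := wJ [set b | J b /\ D (a + b)].
  - by move=> y [].
  - by exists b1.
  exists a, b; split=> //; split=> //; first exact: DC.
  move=> a' b' Ia' Jb' Cab' lt; have Dab' := Ddown _ _ Dab Cab' lt.
  have : a <= a' by apply: la; split=> //; exists b'.
  rewrite le_eqVlt => /predU1P[e|//]; subst a'.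
  have : b <= b' by apply: lb.
  by move: lt; rewrite ltrD2l => /lt_le_trans H /H; rewrite ltxx.
have [||b [Jb [a gab]] lb] := wJ [set b | J b /\ exists a, good a b].
- by move=> y [].
- have [//||//|a [b [gab _]]] := mk C; first by exists c0.
  by exists b; split; [case: gab|exists a].
have [Ia _ Cab gP] := gab.
have [a' [b' [gab' [Cab' lt]]]] :
    exists a' b', good a' b' /\ (C (a' + b') /\ a' + b' < a + b).
  apply: (mk [set c | C c /\ c < a + b]); first by move=> y [].
    by have [c' ? ?] := low _ Cab; exists c'.
  by move=> c c' [Cc cl] Cc' c'c; split=> //; apply: lt_trans cl.
have [Ia' Jb' _ _] := gab'.
have aa' := gP _ _ Ia' Jb' Cab' lt.
have : b <= b' by apply: lb; split=> //; exists a'.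
rewrite leNgt => /negP; apply.
by rewrite -(ltrD2l a); apply: lt_trans lt; rewrite ltrD2r.
Qed.

Lemma finite_set_minmax I : well_ordered I ->
  (forall A, A `<=` I -> A !=set0 -> exists2 m, A m & ubound A m) ->
  finite_set I.
Proof.
move=> wI mI.
have step m : finite_set [set j | I j /\ j < m] -> finite_set [set j | I j /\ j <= m].
  move=> fm; apply: (@sub_finite_set _ _ ([set j | I j /\ j < m] `|` [set m])).
    by move=> j [Ij]; rewrite le_eqVlt => /predU1P[->|]; [right|left].
  by rewrite finite_setU; split=> //; apply: finite_set1.
have H m : I m -> finite_set [set j | I j /\ j < m].
  move=> Im; apply: contrapT => nf.
  have [||k [Ik nk] lk] :=
      wI [set m | I m /\ ~ finite_set [set j | I j /\ j < m]].
  - by move=> y [].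
  - by exists m.
  apply: nk.
  have [ne|ne] := pselect ([set j | I j /\ j < k] !=set0); last first.
    apply: (@sub_finite_set _ _ set0) => // j Hj.
    by case: ne; exists j.
  have [|n [In nk] ln] := mI [set j | I j /\ j < k] _ ne; first by move=> y [].
  apply: (@sub_finite_set _ _ [set j | I j /\ j <= n]).
    by move=> j Hj; split; [case: Hj|apply: ln].
  apply: step; apply: contrapT => nf'.
  by move: nk; rewrite ltNge => /negP; apply; apply: lk.
have [ne|ne] := pselect (I !=set0); last first.
  by apply: (@sub_finite_set _ _ set0) => // j Hj; case: ne; exists j.
have [M IM lM] := mI I (@subset_refl _ _) ne.
apply: (@sub_finite_set _ _ [set j | I j /\ j <= M]).
  by move=> j Ij; split=> //; apply: lM.
exact/step/H.
Qed.

Lemma finite_sumset_fiber I J k : well_ordered I -> well_ordered J ->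
  finite_set [set i | I i /\ J (k - i)].
Proof.
move=> wI wJ; apply: finite_set_minmax.
  by apply: (well_orderedS _ wI) => i [].
move=> A AIJ [a Aa].
have [||m [Jm Akm] lm] := wJ [set j | J j /\ A (k - j)].
- by move=> y [].
- by exists (k - a); split; [case: (AIJ a Aa)|rewrite subKr].
exists (k - m) => // b Ab; rewrite lerBrDr -lerBrDl; apply: lm; split.
  by case: (AIJ b Ab).
by rewrite subKr.
Qed.

End WellOrdered.

Section GenSeries.
Variable F : fieldType.

Definition gs_pred : pred (rat -> F) := fun x =>
  `[< [set i | x i != 0] `<=` [set i | 0 <= i]
      /\ well_ordered [set i | x i != 0] >].

Record genseries := GenSeries { gscoef :> rat -> F; _ : gs_pred gscoef }.

HB.instance Definition _ := [isSub for gscoef].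
HB.instance Definition _ := [Choice of genseries by <:].

Lemma gs_zmod_closed : zmod_closed gs_pred.
Proof.
split.
  by apply/asboolP; split=> [i|A sA [i /sA]] /=; rewrite eqxx.
move=> x y /asboolP[x0 wx] /asboolP[y0 wy]; apply/asboolP.
have S : [set i | (x - y) i != 0] `<=`
    [set i | x i != 0] `|` [set i | y i != 0].
  move=> i /= xyi; have [xi|] := eqVneq (x i) 0; last by left.
  right; apply: contraNneq xyi => yi.
  have -> : (x - y) i = x i - y i by [].
  by rewrite xi yi subr0.
split; first by move=> i /S[/x0|/y0].
exact: well_orderedS S (well_orderedU wx wy).
Qed.

HB.instance Definition _ := GRing.isZmodClosed.Build _ gs_pred gs_zmod_closed.
HB.instance Definition _ := [SubChoice_isSubZmodule of genseries by <:].

Implicit Types x y z : genseries.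

Definition gsupp x : set rat := [set i | x i != 0].

Lemma gsuppN x i : ~ gsupp x i -> x i = 0.
Proof. by move=> /negP/negPn/eqP. Qed.

Lemma gsupp_ge0 x i : gsupp x i -> 0 <= i.
Proof. by have /asboolP[x0 _] := valP x; apply: x0. Qed.

Lemma gsupp_wo x : well_ordered (gsupp x).
Proof. by have /asboolP[] := valP x. Qed.

Lemma gsP x y : (forall i, x i = y i) -> x = y.
Proof. by move=> xy; apply: val_inj; apply: funext. Qed.

Lemma gs0E i : (0 : genseries) i = 0. Proof. by []. Qed.
Lemma gsDE x y i : (x + y) i = x i + y i. Proof. by []. Qed.
Lemma gsNE x i : (- x) i = - x i. Proof. by []. Qed.

(* finitely many nonzero terms, see gs_conv_finite *)
Definition gs_conv x y (k : rat) : F :=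
  \sum_(i \in [set: rat]) x i * y (k - i).

Lemma gs_conv_finite x y k :
  finite_set [set i | gsupp x i /\ gsupp y (k - i)].
Proof. exact: finite_sumset_fiber (@gsupp_wo x) (@gsupp_wo y). Qed.

Lemma gs_convE x y k (s : seq rat) : uniq s ->
  (forall i, gsupp x i -> gsupp y (k - i) -> i \in s) ->
  gs_conv x y k = \sum_(i <- s) x i * y (k - i).
Proof.
move=> us sP; rewrite /gs_conv (fsbigE s) //.
  by apply: eq_bigl => i; rewrite in_setT.
move=> i _ is'; apply/eqP; apply: contraNT is'.
by rewrite mulf_eq0 negb_or => /andP[xi yi]; apply: sP.
Qed.

Lemma gs_conv_supp x y k :
  gs_conv x y k != 0 -> sumset (gsupp x) (gsupp y) k.
Proof.
move=> H; apply: contrapT => nk; move/eqP: H; apply.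
rewrite (@gs_convE _ _ _ [::]) ?big_nil // => i xi yi.
by case: nk; exists i => //; exists (k - i) => //; rewrite addrC subrK.
Qed.

Lemma gs_conv_pred x y : gs_pred (gs_conv x y).
Proof.
apply/asboolP; split=> [k /gs_conv_supp [a /gsupp_ge0 a0 [b /gsupp_ge0 b0 <-]]|].
  exact: addr_ge0.
apply: well_orderedS (well_ordered_sumset (@gsupp_wo x) (@gsupp_wo y)).
exact: gs_conv_supp.
Qed.

Definition gs_mul x y := GenSeries (gs_conv_pred x y).

Lemma gs_one_pred : gs_pred (fun i => (i == 0)%:R).
Proof.
apply/asboolP; split=> [i|A sA [i Ai]] /=.
  by have [->|_] := eqVneq i 0; rewrite ?lexx ?eqxx.
have z j : A j -> j = 0.
  by move=> /sA /=; case: (eqVneq j 0) => //; rewrite eqxx.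
by exists i => // j /z ->; rewrite (z i).
Qed.

Definition gs_one := GenSeries gs_one_pred.

Lemma finite_seqP (T : choiceType) (A : set T) : finite_set A ->
  exists s : seq T, uniq s /\ (forall i, A i <-> i \in s).
Proof.
move=> fA; exists (fset_set A); split; first exact: fset_uniq.
by move=> i; rewrite in_fset_set // in_setE.
Qed.

Lemma gs_mulC : commutative gs_mul.
Proof.
move=> x y; apply: gsP => k /=.
have [s [us sP]] := finite_seqP (gs_conv_finite x y k).
rewrite (@gs_convE _ _ _ s) //; last by move=> i xi yi; apply/sP.
rewrite (@gs_convE _ _ _ [seq k - i | i <- s]).
- by rewrite big_map; apply: eq_bigr => i _; rewrite subKr mulrC.
- by rewrite map_inj_uniq // => a b /addrI /oppr_inj.
move=> i yi xi; apply/mapP; exists (k - i); last by rewrite subKr.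
by apply/sP => /=; rewrite subKr.
Qed.

Lemma gs_mulDl : left_distributive gs_mul +%R.
Proof.
move=> x y z; apply: gsP => k; rewrite gsDE /=.
have [s [us sP]] := finite_seqP (gs_conv_finite x z k).
have [r [ur rP]] := finite_seqP (gs_conv_finite y z k).
pose u := undup (s ++ r).
have uu : uniq u by apply: undup_uniq.
have uP i : (i \in u) = (i \in s) || (i \in r) by rewrite mem_undup mem_cat.
rewrite !(@gs_convE _ _ _ u) //.
- by rewrite -big_split; apply: eq_bigr => i _; rewrite gsDE mulrDl.
- by move=> i yi zi; rewrite uP; apply/orP; right; apply/rP.
- by move=> i xi zi; rewrite uP; apply/orP; left; apply/sP.
move=> i xyi zi; rewrite uP; have [xi|/gsuppN xi] := pselect (gsupp x i).
  by apply/orP; left; apply/sP.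
apply/orP; right; apply/rP; split=> //.
by have := xyi : x i + y i != 0; rewrite xi add0r.
Qed.

Lemma gs_mul1 : left_id gs_one gs_mul.
Proof.
move=> x; apply: gsP => k /=; rewrite (@gs_convE _ _ _ [:: 0]) //.
  by rewrite big_seq1 /= mul1r subr0.
move=> i H _; rewrite inE; have : (i == 0)%:R != 0 :> F := H.
by case: (i == 0) => //; rewrite mulr0n eqxx.
Qed.

Lemma gs_mulA : associative gs_mul.
Proof.
move=> x y z; apply: gsP => k.
have [s [us sP]] := finite_seqP (finite_sumset_fiber k (@gsupp_wo x)
  (well_ordered_sumset (@gsupp_wo y) (@gsupp_wo z))).
have [r [ur rP]] := finite_seqP (finite_sumset_fiber k
  (well_ordered_sumset (@gsupp_wo x) (@gsupp_wo y)) (@gsupp_wo z)).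
rewrite /=.
rewrite (@gs_convE x (gs_mul y z) k s) //; last first.
  by move=> i xi yzi; apply/sP; split=> //; apply: gs_conv_supp.
rewrite (@gs_convE (gs_mul x y) z k r) //; last first.
  by move=> i xi yzi; apply/rP; split=> //; apply: gs_conv_supp.
transitivity (\sum_(i <- s) \sum_(j <- r) x i * y (j - i) * z (k - j)).
  apply: eq_bigr => i _ /=.
  have [xi|/gsuppN xi] := pselect (gsupp x i); last first.
    by rewrite xi mul0r big1 // => j _; rewrite !mul0r.
  rewrite (@gs_convE _ _ _ [seq j - i | j <- r]).
  - rewrite big_map mulr_sumr; apply: eq_bigr => j _.
    by rewrite mulrA opprB addrA subrK.
  - by rewrite map_inj_uniq // => a b /addIr.
  move=> l yl zl; apply/mapP; exists (i + l); last by rewrite addrC addKr.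
  apply/rP; split; first by exists i => //; exists l.
  by rewrite opprD addrA.
rewrite exchange_big; apply: eq_bigr => j _ /=.
have [zj|/gsuppN zj] := pselect (gsupp z (k - j)); last first.
  by rewrite zj mulr0 big1 // => i _; rewrite !mulr0.
rewrite (@gs_convE _ _ _ s) // ?mulr_suml // => i xi yi.
apply/sP; split=> //; exists (j - i) => //; exists (k - j) => //.
by rewrite addrC addrA subrK.
Qed.

Lemma gs_one_neq0 : gs_one != 0.
Proof.
apply/eqP => /(congr1 (fun x : genseries => x 0)) /eqP.
by rewrite gs0E /= oner_eq0.
Qed.

HB.instance Definition _ := GRing.Zmodule_isComNzRing.Build genseries
  gs_mulA gs_mulC gs_mul1 gs_mulDl gs_one_neq0.

Lemma gs1E i : (1 : genseries) i = (i == 0)%:R. Proof. by []. Qed.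
Lemma gsME x y k : (x * y) k = \sum_(i \in [set: rat]) x i * y (k - i).
Proof. by []. Qed.

Definition gs_of_poly_coef (P : {poly F}) (i : rat) : F :=
  if i \is a Num.nat then P`_(Num.truncn i) else 0.

Lemma gs_of_poly_pred P : gs_pred (gs_of_poly_coef P).
Proof.
apply/asboolP.
have S i : gs_of_poly_coef P i != 0 -> i \is a Num.nat.
  by rewrite /gs_of_poly_coef; case: ifP; rewrite ?eqxx.
split=> [i /S /natr_ge0//|A sA [a Aa]].
have N j : A j -> exists n : nat, j = n%:R by move=> /sA /S /natrP.
have ex : exists n : nat, `[< A n%:R >].
  by have [n e] := N _ Aa; exists n; apply/asboolP; rewrite -e.
case: (ex_minnP ex) => m /asboolP Am mP; exists m%:R => // j Aj.
by have [n e] := N _ Aj; rewrite e ler_nat mP //; apply/asboolP; rewrite -e.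
Qed.

Definition gs_of_poly (P : {poly F}) : genseries :=
  GenSeries (gs_of_poly_pred P).

Lemma gs_of_poly_nat P n : gs_of_poly P n%:R = P`_n.
Proof. by rewrite /= /gs_of_poly_coef natr_nat natrK. Qed.

Lemma gs_of_poly_nnat P i : i \isn't a Num.nat -> gs_of_poly P i = 0.
Proof. by rewrite /= /gs_of_poly_coef => /negPf ->. Qed.

Lemma gs_of_poly_is_zmod_morphism : zmod_morphism gs_of_poly.
Proof.
move=> P Q; apply: gsP => i; rewrite gsDE gsNE.
have [/natrP[n ->]|ni] := boolP (i \is a Num.nat).
  by rewrite !gs_of_poly_nat coefB.
by rewrite !gs_of_poly_nnat // subr0.
Qed.

Lemma gs_of_poly_is_monoid_morphism : monoid_morphism gs_of_poly.
Proof.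
split=> [|P Q]; apply: gsP => k.
  rewrite gs1E; have [/natrP[n ->]|nk] := boolP (k \is a Num.nat).
    by rewrite gs_of_poly_nat coef1 pnatr_eq0.
  by rewrite gs_of_poly_nnat //; case: eqVneq nk => // ->; rewrite nat_num0.
rewrite gsME -/(gs_conv _ _ _).
have suppP R i : gsupp (gs_of_poly R) i -> exists n : nat, i = n%:R.
  move=> H; apply/natrP; apply: contraT => ni.
  have : gs_of_poly R i != 0 := H.
  by rewrite gs_of_poly_nnat ?eqxx.
have [/natrP[n ->]|nk] := boolP (k \is a Num.nat); last first.
  rewrite gs_of_poly_nnat // (@gs_convE _ _ _ [::]) ?big_nil //.
  move=> i /suppP[m ->] /suppP[l e]; case/negP: nk.
  by rewrite -(subrK m%:R k) e -natrD natr_nat.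
rewrite gs_of_poly_nat coefM.
rewrite (@gs_convE _ _ _ [seq m%:R | m <- iota 0 n.+1]).
- rewrite big_map -[iota 0 n.+1]/(index_iota 0 n.+1) big_mkord.
  apply: eq_bigr => i _.
  by rewrite -natrB ?gs_of_poly_nat // -ltnS.
- by rewrite map_inj_uniq ?iota_uniq // => a b /eqP; rewrite eqr_nat => /eqP.
move=> i /suppP[m ->] /gsupp_ge0; rewrite subr_ge0 ler_nat => mn.
by apply/mapP; exists m => //; rewrite mem_iota.
Qed.

HB.instance Definition _ := GRing.isZmodMorphism.Build {poly F} genseries
  gs_of_poly gs_of_poly_is_zmod_morphism.
HB.instance Definition _ := GRing.isMonoidMorphism.Build {poly F} genseries
  gs_of_poly gs_of_poly_is_monoid_morphism.

Lemma gs_of_poly_inj : injective gs_of_poly.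
Proof.
move=> P Q PQ; apply/polyP => n.
by rewrite -!gs_of_poly_nat PQ.
Qed.

End GenSeries.

(* algebraicOver of mxpoly, which is restricted to fields, for rings *)
Definition ralgebraicOver (R K : nzRingType) (RtoK : R -> K) (u : K) : Prop :=
  exists2 P : {poly R}, P != 0 & root (map_poly RtoK P) u.

Record automaton (Sigma O : finType) := Automaton {
  state : finType;
  init : state;
  output : state -> O;
  trans : Sigma -> state -> state
}.

Definition run (Sigma O : finType) (M : automaton Sigma O) (w : seq Sigma) : O :=
  output (foldl (fun s a => trans a s) (init M) w).

Definition Zinvp (p : nat) : set rat :=
  [set i | exists (m : int) (k : nat), i = m%:~R / p%:R ^+ k].

Section BaseRep.
Variable p : nat.

(* Some d is the digit d, None is the radix point *)
Definition symbol : finType := option 'I_p.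

Definition digits_val (ds : seq 'I_p) : nat :=
  foldl (fun n (d : 'I_p) => (n * p + d)%N) 0%N ds.

(* The integer part is never empty: 0 is written "0" and 1/p is written "0.1". *)
Definition int_part_ok (ds : seq 'I_p) : bool :=
  (size ds == 1)%N || (0 < head 0 [seq val d | d <- ds])%N.

Definition frac_part_ok (fs : seq 'I_p) : bool :=
  (0 < last 1 [seq val d | d <- fs])%N.

Definition radix_string (ds fs : seq 'I_p) : seq symbol :=
  if fs is [::] then map Some ds else map Some ds ++ None :: map Some fs.

Definition is_base_rep (i : rat) (w : seq symbol) : Prop :=
  exists ds fs, [/\ int_part_ok ds, frac_part_ok fs, w = radix_string ds fs &
    i = (digits_val ds)%:R + (digits_val fs)%:R / p%:R ^+ size fs].

Lemma digits_val_rcons ds d : digits_val (rcons ds d) = (digits_val ds * p + d)%N.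
Proof. by rewrite /digits_val -cats1 foldl_cat. Qed.

Lemma digits_val_cat ds es :
  digits_val (ds ++ es) = (digits_val ds * p ^ size es + digits_val es)%N.
Proof.
elim/last_ind: es => [|es e IH]; first by rewrite cats0 muln1 addn0.
rewrite -rcons_cat !digits_val_rcons IH size_rcons expnSr mulnDl mulnA.
by rewrite addnA.
Qed.

Lemma digits_val_lt ds : (digits_val ds < p ^ size ds)%N.
Proof.
elim/last_ind: ds => [|ds d IH]; first by rewrite expn0.
rewrite digits_val_rcons size_rcons expnSr.
have := leq_mul IH (leqnn p); rewrite mulSn addnC; apply: leq_trans.
by rewrite ltn_add2l.
Qed.

Lemma digits_val_inj ds es :
  size ds = size es -> digits_val ds = digits_val es -> ds = es.
Proof.
elim/last_ind: ds es => [|ds d IH] es; first by case: es.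
case/lastP: es => [|es e]; rewrite !size_rcons // => -[sz].
have p0 : (0 < p)%N by apply: leq_ltn_trans (ltn_ord d).
rewrite !digits_val_rcons => H.
have /(IH _ sz)-> : digits_val ds = digits_val es.
  have := congr1 (divn^~ p) H.
  by rewrite /= !divnMDl // !divn_small // !addn0.
congr rcons; apply: val_inj.
have := congr1 (modn^~ p) H.
by rewrite /= !modnMDl !modn_small.
Qed.

Hypothesis p_gt1 : (1 < p)%N.

Let p_gt0 : (0 < p)%N := ltnW p_gt1.

Lemma digits_val_ex k n : (n < p ^ k)%N ->
  exists2 ds : seq 'I_p, size ds = k & digits_val ds = n.
Proof.
elim: k n => [|k IH] n; first by case: n => // _; exists [::].
rewrite expnSr -ltn_divLR // => /IH[ds sz v].
exists (rcons ds (Ordinal (ltn_pmod n p_gt0))); first by rewrite size_rcons sz.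
by rewrite digits_val_rcons v /= -divn_eq.
Qed.

Lemma int_part_ex n : exists2 ds, int_part_ok ds & digits_val ds = n.
Proof.
have [m] := ubnP n; elim: m n => // m IH n; rewrite ltnS => nm.
have [np|pn] := ltnP n p; first by exists [:: Ordinal np].
have n0 : (0 < n)%N by apply: leq_trans pn.
have [|ds ok v] := IH (n %/ p)%N; first by apply: leq_trans nm; apply: ltn_Pdiv.
exists (rcons ds (Ordinal (ltn_pmod n p_gt0))); last first.
  by rewrite digits_val_rcons v /= -divn_eq.
rewrite /int_part_ok; apply/orP; right.
have : (0 < digits_val ds)%N by rewrite v divn_gt0.
case: ds ok {v} => [//|d [|d' ds]] //=.
Qed.

Lemma int_part_inj ds es : int_part_ok ds -> int_part_ok es ->
  digits_val ds = digits_val es -> ds = es.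
Proof.
have lt ds' es' : int_part_ok ds' -> int_part_ok es' ->
    (size ds' < size es')%N -> (digits_val ds' < digits_val es')%N.
  move=> dok eok sz; apply: leq_trans (digits_val_lt ds') _.
  case: es' eok sz => // e es' eok; rewrite [size _]/= ltnS => sz.
  have e0 : (0 < e)%N.
    case/orP: eok => //; case: es' sz => // /=; rewrite leqn0.
    by case: ds' dok.
  rewrite -cat1s digits_val_cat.
  apply: leq_trans (leq_addr _ _).
  apply: leq_trans (leq_pmull _ _); last by rewrite /digits_val /= mul0n.
  by rewrite leq_exp2l.
move=> dok eok v; apply: digits_val_inj (v).
have [l|l|//] := ltngtP (size ds) (size es).
  by have := lt _ _ dok eok l; rewrite v ltnn.
by have := lt _ _ eok dok l; rewrite v ltnn.
Qed.

Lemma is_base_rep_ex i : 0 <= i -> Zinvp p i -> exists w, is_base_rep i w.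
Proof.
move=> i0 [m [k e]].
have pR : p%:R != 0 :> rat by rewrite pnatr_eq0 -lt0n.
have {m e} [n e] : exists n : nat, i = n%:R / p%:R ^+ k.
  move: i0; rewrite e pmulr_lge0 ?invr_gt0 ?exprn_gt0 ?ltr0n // ler0z.
  by case: m {e} => // n _; exists n.
elim: k n e => [|k IH] n e.
  have [ds ok v] := int_part_ex n.
  exists (radix_string ds [::]), ds, [::]; split=> //.
  by rewrite v e addrC mul0r add0r invr1 mulr1.
have [pn|pn] := boolP (p %| n)%N.
  apply: (IH (n %/ p)%N); rewrite e -{1}(divnK pn) natrM exprSr invfM.
  by rewrite [_^-1 / _]mulrC mulrA mulfK.
have [ds ok v] := int_part_ex (n %/ p ^ k.+1)%N.
have pk0 : (0 < p ^ k.+1)%N by rewrite expn_gt0 p_gt0.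
have [fs sz w] := digits_val_ex (ltn_pmod n pk0).
exists (radix_string ds fs), ds, fs; split=> //.
  case/lastP: fs sz w => [//|fs f] _; rewrite digits_val_rcons => w.
  rewrite /frac_part_ok map_rcons last_rcons lt0n.
  apply: contra pn => /eqP f0.
  rewrite (divn_eq n (p ^ k.+1)) -w [val f]f0 addn0 dvdn_add ?dvdn_mull //.
  by rewrite expnS dvdn_mulr.
rewrite sz v w e {1}(divn_eq n (p ^ k.+1)) natrD natrM mulrDl natrX mulfK //.
by rewrite expf_neq0.
Qed.

Lemma is_base_rep_inj i w w' : is_base_rep i w -> is_base_rep i w' -> w = w'.
Proof.
move=> [ds [fs [dok fok -> e]]] [ds' [fs' [dok' fok' -> e']]].
have pR : p%:R != 0 :> rat by rewrite pnatr_eq0 -lt0n.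
have sum (es gs : seq 'I_p) :
    (digits_val es)%:R + (digits_val gs)%:R / p%:R ^+ size gs
    = (digits_val (es ++ gs))%:R / p%:R ^+ size gs :> rat.
  by rewrite digits_val_cat natrD natrM natrX mulrDl mulfK ?expf_neq0.
have H : (digits_val (ds ++ fs) * p ^ size fs'
        = digits_val (ds' ++ fs') * p ^ size fs)%N.
  apply/eqP; rewrite -(eqr_nat rat) !natrM !natrX.
  by rewrite -eqr_div ?expf_neq0 // -!sum -e -e'.
have nlt es gs es' gs' : frac_part_ok gs' ->
    (digits_val (es ++ gs) * p ^ size gs'
       = digits_val (es' ++ gs') * p ^ size gs)%N ->
    ~ (size gs < size gs')%N.
  move=> gok eq lt.
  have pk : (0 < p ^ size gs)%N by rewrite expn_gt0 p_gt0.
  have /eqP : (digits_val (es ++ gs) * p ^ (size gs' - size gs) * p ^ size gs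
      = digits_val (es' ++ gs') * p ^ size gs)%N.
    by rewrite -mulnA -expnD subnK // ltnW.
  rewrite eqn_pmul2r // => /eqP eq'.
  have : (p %| digits_val (es' ++ gs'))%N.
    by rewrite -eq' dvdn_mull // -(prednK (_ : 0 < _ - _)%N) ?subn_gt0 // expnS dvdn_mulr.
  case/lastP: gs' gok lt {eq eq'} => // gs' g gok _; move: gok.
  rewrite /frac_part_ok map_rcons last_rcons => g0.
  rewrite -rcons_cat digits_val_rcons dvdn_addr ?dvdn_mull //.
  by rewrite gtnNdvd.
have sz : size fs = size fs'.
  have := nlt _ _ _ _ fok' H; have := nlt _ _ _ _ fok (esym H).
  by case: ltngtP.
have /eqP := H; rewrite sz eqn_pmul2r ?expn_gt0 ?p_gt0 // => /eqP.
rewrite !digits_val_cat sz => eq.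
have pk : (0 < p ^ size fs')%N by rewrite expn_gt0 p_gt0.
have lt_fs : (digits_val fs < p ^ size fs')%N by rewrite -sz digits_val_lt.
have -> : ds = ds'.
  apply: int_part_inj => //; have := congr1 (divn^~ (p ^ size fs')%N) eq.
  by rewrite /= !divnMDl // !divn_small ?digits_val_lt // !addn0.
have -> // : fs = fs'.
apply: digits_val_inj => //; have := congr1 (modn^~ (p ^ size fs')%N) eq.
by rewrite /= !modnMDl !modn_small ?digits_val_lt.
Qed.

End BaseRep.

Definition automatic (p : nat) (F : finFieldType) (x : genseries F) : Prop :=
  gsupp x `<=` Zinvp p /\
  exists M : automaton (symbol p) F,
    forall i : rat, 0 <= i -> Zinvp p i ->
    forall w : seq (symbol p), is_base_rep i w -> run M w = x i.

(* Main.v *)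
Require Import Defs.
From mathcomp Require Import all_boot all_order all_algebra all_field.
From mathcomp Require Import boolp classical_sets.
From mathcomp Require Import ring lra zify.

(* Algebraic implies automatic. An algebraic x satisfies a linear relation
   sum_j a_j x^(q^j) = 0 over F[t]; since x^(q^j) is x(i / q^j) coefficientwise,
   this relates the values of x at finitely many affine images of i. After taking
   a q-power and dividing by the lowest coefficient, x becomes a polynomial multiple
   of a Y with Y = sum_(j > 0) b_j Y^(q^j).
   Call a function good if each of its windows [a, a + 1) is recognizable in the
   fractional digits, i.e. has a finite-dimensional space of digit quotients. Let
   alpha be a threshold such that the truncations of Y at smaller thresholds are good.
   The terms of the relation that reach furthest (a Newton polygon condition) give
   an equation with constant coefficients for the part of Y just below alpha, and the
   others only involve smaller truncations; so the truncation at alpha is good too.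
   Hence Y is good by well-ordering, and then the windows of Y at n p + d are
   determined by finitely many windows near n, with a finite state space.

   Automatic implies algebraic. With D the number of pairs (state, vector), one
   finds D series E_k such that x, x^q, ..., x^(q^D) all lie in the F[t]-module
   spanned by the E_k, so these D + 1 powers are linearly dependent over F[t]. *)

Set Implicit Arguments.
Unset Strict Implicit.
Unset Printing Implicit Defensive.

Import Order.TTheory GRing.Theory Num.Theory.
Local Open Scope classical_set_scope.
Local Open Scope ring_scope.

(** * Recognizable functions of digit strings *)

Section Recognizable.
Variables (F : fieldType) (p : nat).
Implicit Types (g h : seq 'I_p -> F) (fs : seq 'I_p).

Definition word_mulmx n (A : 'I_p -> 'M[F]_n) (w : 'cV[F]_n) fs : 'cV[F]_n :=
  foldr (fun d u => A d *m u) w fs.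

(** A rational noncommutative series, given by a linear representation. Digits act on the left of
    [w], so a digit quotient only replaces [v] by [v *m A d]. *)
Definition recognizable g : Prop :=
  exists n (A : 'I_p -> 'M[F]_n) (w : 'cV[F]_n) (v : 'rV[F]_n),
    forall fs, g fs = (v *m word_mulmx A w fs) 0 0.

(** Block diagonal matrices juxtapose the representations. With [A] and [w] shared, only the row
    vector depends on the index, so row vectors can serve as states. *)
Lemma recognizable_family (I : finType) (g : I -> seq 'I_p -> F) :
  (forall i, recognizable (g i)) ->
  exists n (A : 'I_p -> 'M[F]_n) (w : 'cV[F]_n) (v : I -> 'rV[F]_n),
    forall i fs, g i fs = (v i *m word_mulmx A w fs) 0 0.
Proof.
move=> rg.
suff [n [A [w [v H]]]] : exists n (A : 'I_p -> 'M[F]_n) (w : 'cV[F]_n)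
    (v : I -> 'rV[F]_n), forall i, i \in enum I ->
    forall fs, g i fs = (v i *m word_mulmx A w fs) 0 0.
  by exists n, A, w, v => i; apply: H; rewrite mem_enum.
elim: (enum I) => [|i0 s [n [A [w [v IH]]]]].
  by exists 0%N, (fun=> 0), 0, (fun=> 0).
have [m [B [u [x Hx]]]] := rg i0.
exists (m + n)%N, (fun d => block_mx (B d) 0 0 (A d)), (col_mx u w),
  (fun i => if i == i0 then row_mx x 0 else row_mx 0 (v i)) => i.
have E fs : word_mulmx (fun d => block_mx (B d) 0 0 (A d)) (col_mx u w) fs
    = col_mx (word_mulmx B u fs) (word_mulmx A w fs).
  elim: fs => //= d fs ->.
  by rewrite mul_block_col !mul0mx addr0 add0r.
rewrite inE; case: eqVneq => [-> _|_ /= /IH gi] fs.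
  by rewrite E mul_row_col mul0mx addr0 Hx.
by rewrite E mul_row_col mul0mx add0r gi.
Qed.

Lemma recognizable_ext g h : g =1 h -> recognizable g -> recognizable h.
Proof.
by move=> gh [n [A [w [v H]]]]; exists n, A, w, v => fs; rewrite -gh.
Qed.

Lemma recognizable0 : recognizable (fun=> 0).
Proof. by exists 0%N, (fun=> 0), 0, 0 => fs; rewrite mul0mx mxE. Qed.

Lemma recognizable_sum (I : finType) (c : I -> F) (g : I -> seq 'I_p -> F) :
  (forall i, recognizable (g i)) ->
  recognizable (fun fs => \sum_i c i * g i fs).
Proof.
move=> /recognizable_family[n [A [w [v H]]]].
exists n, A, w, (\sum_i c i *: v i) => fs.
rewrite mulmx_suml summxE; apply: eq_bigr => i _.
by rewrite -scalemxAl mxE H.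
Qed.

Lemma recognizableD g h :
  recognizable g -> recognizable h -> recognizable (fun fs => g fs + h fs).
Proof.
move=> rg rh; have := @recognizable_sum _ (fun=> 1) (fun b => if b then g else h).
move=> /(_ ltac:(by case)); apply: recognizable_ext => fs.
by rewrite big_bool !mul1r.
Qed.

Lemma recognizableZ c g : recognizable g -> recognizable (fun fs => c * g fs).
Proof.
move=> rg; have := @recognizable_sum unit (fun=> c) (fun=> g) (fun=> rg).
by apply: recognizable_ext => fs; rewrite big_const card_unit /= addr0.
Qed.

Lemma recognizable_cons g d : recognizable g -> recognizable (fun fs => g (d :: fs)).
Proof.
move=> [n [A [w [v H]]]]; exists n, A, w, (v *m A d) => fs.
by rewrite H /= mulmxA.
Qed.

Lemma recognizable_system (I : finType) (c : I -> 'I_p -> I -> F)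
    (r : I -> 'I_p -> seq 'I_p -> F) (g : I -> seq 'I_p -> F) :
  (forall i d fs, g i (d :: fs) = \sum_j c i d j * g j fs + r i d fs) ->
  (forall i d, recognizable (r i d)) -> forall i, recognizable (g i).
Proof.
move=> gE rr.
have [n [A [w [v H]]]] := @recognizable_family (I * 'I_p)%type
  (fun k => r k.1 k.2) (fun k => rr k.1 k.2).
pose G fs : 'cV[F]_#|I| := \col_k g (enum_val k) fs.
pose C d : 'M[F]_#|I| := \matrix_(k, l) c (enum_val k) d (enum_val l).
pose V d : 'M[F]_(#|I|, n) := \matrix_(k, l) v (enum_val k, d) 0 l.
pose B d := block_mx (C d) (V d) 0 (A d).
have GE fs : word_mulmx B (col_mx (G [::]) w) fs = col_mx (G fs) (word_mulmx A w fs).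
  elim: fs => //= d fs ->; rewrite mul_block_col mul0mx add0r; congr col_mx.
  apply/colP => k; rewrite !mxE gE; congr (_ + _).
    rewrite [RHS]big_enum_val /=.
    by apply: eq_bigr => l _; rewrite !mxE.
  rewrite (H (_, _)) mxE; apply: eq_bigr => l _; by rewrite !mxE.
move=> i; exists (#|I| + n)%N, B, (col_mx (G [::]) w),
  (row_mx (delta_mx 0 (enum_rank i)) 0) => fs.
by rewrite GE mul_row_col mul0mx addr0 -rowE !mxE enum_rankK.
Qed.

Section SpanModulo.
Variables (I : finType) (g : I -> seq 'I_p -> F).

Definition span_mod h : Prop := exists (c : I -> F) (r : seq 'I_p -> F),
  recognizable r /\ forall fs, h fs = \sum_j c j * g j fs + r fs.

Lemma span_mod_ext h h' : h =1 h' -> span_mod h -> span_mod h'.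
Proof. by move=> hh [c [r [rr H]]]; exists c, r; split=> // fs; rewrite -hh. Qed.

Lemma span_mod_recognizable h : recognizable h -> span_mod h.
Proof.
move=> rh; exists (fun=> 0), h; split=> // fs.
by rewrite big1 ?add0r // => j _; rewrite mul0r.
Qed.

Lemma span_mod0 : span_mod (fun=> 0).
Proof. exact/span_mod_recognizable/recognizable0. Qed.

Lemma span_mod_gen i : span_mod (g i).
Proof.
exists (fun j => (j == i)%:R), (fun=> 0); split; first exact: recognizable0.
move=> fs; rewrite addr0 (bigD1 i) //= eqxx mul1r big1 ?addr0 // => j /negPf ->.
by rewrite mul0r.
Qed.

Lemma span_modD h h' : span_mod h -> span_mod h' -> span_mod (fun fs => h fs + h' fs).
Proof.
move=> [c [r [rr H]]] [c' [r' [rr' H']]].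
exists (fun j => c j + c' j), (fun fs => r fs + r' fs); split.
  exact: recognizableD.
move=> fs; rewrite H H' addrACA -big_split; congr (_ + _).
by apply: eq_bigr => j _; rewrite mulrDl.
Qed.

Lemma span_modZ a h : span_mod h -> span_mod (fun fs => a * h fs).
Proof.
move=> [c [r [rr H]]]; exists (fun j => a * c j), (fun fs => a * r fs); split.
  exact: recognizableZ.
move=> fs; rewrite H mulrDr mulr_sumr; congr (_ + _).
by apply: eq_bigr => j _; rewrite mulrA.
Qed.

Lemma span_mod_sum (J : Type) (s : seq J) (P : pred J) (h : J -> seq 'I_p -> F) :
  (forall k, P k -> span_mod (h k)) ->
  span_mod (fun fs => \sum_(k <- s | P k) h k fs).
Proof.
move=> sh; elim: s => [|k s IH].
  by apply: span_mod_ext span_mod0 => fs; rewrite big_nil.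
apply: (@span_mod_ext (fun fs => (if P k then h k fs else 0) +
    \sum_(k <- s | P k) h k fs)).
  by move=> fs; rewrite big_cons; case: ifP; rewrite ?add0r.
by apply: span_modD IH; case: (boolP (P k)) => Pk; [apply: sh|apply: span_mod0].
Qed.

Hypothesis gE : forall i d, span_mod (fun fs => g i (d :: fs)).

(** Choosing coefficients and remainders for each [g i] and each digit yields a
    [recognizable_system]. *)
Lemma span_mod_closed_recognizable h : span_mod h -> recognizable h.
Proof.
have crE : forall k : I * 'I_p, exists cr : (I -> F) * (seq 'I_p -> F),
    recognizable cr.2 /\ forall fs, g k.1 (k.2 :: fs) = \sum_j cr.1 j * g j fs + cr.2 fs.
  by move=> k; have [c [r H]] := gE k.1 k.2; exists (c, r).
have [cr crP] := choice crE.
have rg : forall i, recognizable (g i).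
  apply: (@recognizable_system _ (fun i d => (cr (i, d)).1) (fun i d => (cr (i, d)).2)).
    by move=> i d fs; have [_ ->] := crP (i, d).
  by move=> i d; have [] := crP (i, d).
move=> [c [r [rr H]]]; apply: (@recognizable_ext (fun fs => \sum_j c j * g j fs + r fs)).
  by move=> fs; rewrite H.
by apply: recognizableD rr; apply: recognizable_sum.
Qed.

End SpanModulo.

Lemma recognizable_uncons g :
  (forall d, recognizable (fun fs => g (d :: fs))) -> recognizable g.
Proof.
move=> rg; apply: (@span_mod_closed_recognizable unit (fun=> g)) (span_mod_gen _ tt).
by move=> _ d; apply: span_mod_recognizable.
Qed.

End Recognizable.

(** * Functions with recognizable windows *)

Section FracValue.
Variable p : nat.
Hypothesis p_gt1 : (1 < p)%N.
Implicit Types ds fs : seq 'I_p.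

Definition frac_val fs : rat := foldr (fun (d : 'I_p) z => (d%:R + z) / p%:R) 0 fs.

Lemma pR_gt0 : 0 < p%:R :> rat.
Proof. by rewrite ltr0n ltnW. Qed.

Lemma pR_neq0 : p%:R != 0 :> rat.
Proof. by rewrite gt_eqF ?pR_gt0. Qed.

Lemma pX_gt0 n : 0 < p%:R ^+ n :> rat.
Proof. by rewrite exprn_gt0 ?pR_gt0. Qed.

Lemma pX_neq0 n : p%:R ^+ n != 0 :> rat.
Proof. by rewrite gt_eqF ?pX_gt0. Qed.

Lemma frac_val_ge0 fs : 0 <= frac_val fs.
Proof.
by elim: fs => //= d fs IH; rewrite divr_ge0 ?addr_ge0 ?ler0n.
Qed.

Lemma frac_val_lt1 fs : frac_val fs < 1.
Proof.
elim: fs => [|d fs IH] /=; first exact: ltr01.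
rewrite ltr_pdivrMr ?pR_gt0 // mul1r.
have : d%:R + 1 <= p%:R :> rat by rewrite natr1 ler_nat ltn_ord.
lra.
Qed.

Lemma frac_valE fs : frac_val fs = (digits_val fs)%:R / p%:R ^+ size fs.
Proof.
elim: fs => [|d fs IH] /=; first by rewrite /digits_val mul0r.
rewrite IH -cat1s digits_val_cat {1 2}/digits_val /= mul0n add0n natrD natrM natrX exprS.
have := pR_neq0; have := pX_neq0 (size fs) => *; field.
by apply/andP.
Qed.

Lemma shift_radix ds fs es :
  ((digits_val (ds ++ es))%:R + frac_val fs) / p%:R ^+ size es
    = (digits_val ds)%:R + frac_val (es ++ fs).
Proof.
elim: es ds => [|e es IH] ds /=; first by rewrite cats0 divr1.
rewrite -cat_rcons exprS.
have := IH (rcons ds e); rewrite digits_val_rcons natrD natrM => H.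
have -> : ((digits_val (rcons ds e ++ es))%:R + frac_val fs) / (p%:R * p%:R ^+ size es)
   = ((digits_val (rcons ds e ++ es))%:R + frac_val fs) / p%:R ^+ size es / p%:R.
  by field; rewrite pR_neq0 -?exprE pX_neq0.
rewrite H; field; exact: pR_neq0.
Qed.

End FracValue.

Section Good.
Variables (F : fieldType) (p : nat).
Hypothesis p_gt1 : (1 < p)%N.
Implicit Types (f h : rat -> F).

Definition good f : Prop :=
  forall a : rat, recognizable (fun fs : seq 'I_p => f (a + frac_val fs)).

Lemma good_ext f h : f =1 h -> good f -> good h.
Proof. by move=> fh gf a; apply: recognizable_ext (gf a) => fs; rewrite fh. Qed.

Lemma good0 : good (fun=> 0).
Proof. by move=> a; apply: recognizable0. Qed.

Lemma goodD f h : good f -> good h -> good (fun i => f i + h i).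
Proof. by move=> gf gh a; apply: recognizableD. Qed.

Lemma goodZ c f : good f -> good (fun i => c * f i).
Proof. by move=> gf a; apply: recognizableZ. Qed.

Lemma good_sum (I : finType) (P : pred I) (f : I -> rat -> F) :
  (forall k, P k -> good (f k)) -> good (fun i => \sum_(k | P k) f k i).
Proof.
move=> gf; suff : good (fun i => \sum_k (P k)%:R * f k i).
  apply: good_ext => i; rewrite [RHS]big_mkcond; apply: eq_bigr => k _.
  by case: ifP; rewrite ?mul1r ?mul0r.
move=> a; have H k : recognizable (fun fs : seq 'I_p => (P k)%:R * f k (a + frac_val fs)).
  have [Pk|_] := boolP (P k); first by apply/recognizableZ/gf.
  by apply: recognizable_ext (@recognizable0 _ _) => fs; rewrite mul0r.
apply: recognizable_ext (recognizable_sum (fun=> 1) H) => fs.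
by apply: eq_bigr => k _; rewrite mul1r.
Qed.

Lemma good_shift b f : good f -> good (fun i => f (i + b)).
Proof.
by move=> gf a; apply: recognizable_ext (gf (a + b)) => fs; rewrite addrAC.
Qed.

Lemma good_div f : good f -> good (fun i => f (i / p%:R)).
Proof.
move=> gf a; have p0 : (0 < p)%N by apply: ltnW.
apply: recognizable_ext (recognizable_cons (Ordinal p0) (gf (a / p%:R))) => fs /=.
by rewrite add0r mulrDl.
Qed.

Lemma good_divX n f : good f -> good (fun i => f (i / p%:R ^+ n)).
Proof.
elim: n f => [|n IH] f gf; first by apply: good_ext gf => i; rewrite divr1.
apply: good_ext (IH _ (good_div gf)) => i /=.
by rewrite exprSr invfM mulrA mulrAC.
Qed.

End Good.

Section GoodSystem.
Variables (F : fieldType) (p : nat).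
Hypothesis p_gt1 : (1 < p)%N.
Implicit Types (f h : rat -> F).

Lemma rat_fracE (a : rat) : exists2 D : nat, (0 < D)%N & exists m : int, a = m%:~R / D%:R.
Proof.
exists `|denq a|%N; first by rewrite absz_gt0 denq_neq0.
exists (numq a); rewrite -{1}(divq_num_den a); congr (_ / _).
by rewrite -[in LHS]absz_denq.
Qed.

(** Prepending the digit d turns the condition z = c into z = p c - d, which keeps the denominator D
    of c. The indicators of the points t / D in [0, 1) thus span a stable space, those of outer
    points being zero. *)
Lemma good_delta b : good p (fun i => (i == b)%:R : F).
Proof.
move=> a; have [D D0 [m ab]] := rat_fracE (b - a).
have DR : 0 < D%:R :> rat by rewrite ltr0n.
pose chi (c : rat) (fs : seq 'I_p) : F := (frac_val fs == c)%:R.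
pose g (t : 'I_D) := chi (t%:R / D%:R).
have gP (l : int) : span_mod g (chi (l%:~R / D%:R)).
  case: (boolP (0 <= l < D%:Z)) => [/andP[]|out].
    case: l => // t _ tD; have {}tD : (t < D)%N by [].
    by apply: span_mod_ext (span_mod_gen g (Ordinal tD)).
  apply: span_mod_ext (span_mod0 g) => fs; rewrite /chi.
  case: eqP => // /esym H; case/negP: out.
  have lE : l%:~R = frac_val fs * D%:R :> rat by rewrite -H divfK ?gt_eqF.
  rewrite -(ler0z rat) -(ltr_int rat) lE mulr_ge0 ?frac_val_ge0 ?ler0n //=.
  by rewrite -pmulrn gtr_pMl ?frac_val_lt1.
apply: (@recognizable_ext _ _ (chi (b - a))).
  by move=> fs; rewrite /chi eq_sym subr_eq addrC eq_sym.
rewrite ab; apply: (@span_mod_closed_recognizable _ _ _ g) (gP m) => t d.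
apply: span_mod_ext (gP (p%:Z * t%:Z - d%:Z * D%:Z)) => fs.
rewrite /g /chi /=; congr (nat_of_bool _)%:R.
rewrite rmorphB !rmorphM /= -!pmulrn.
have := pR_neq0 p_gt1 => p0; have D0' : D%:R != 0 :> rat by rewrite gt_eqF.
apply/eqP/eqP => H; first by rewrite H; field; apply/andP.
have -> : frac_val fs = p%:R * ((d%:R + frac_val fs) / p%:R) - d%:R.
  by field.
by rewrite H; field.
Qed.

(* The windows of f (l / p^j) for j <= e k1, at the finitely many offsets (in the
   denominator of a) that meet the support of f, span a space stable under digit
   quotients modulo recognizable functions: reading a digit raises j by one, and the
   term k1 of the equation brings j = e k1 + 1 back into range. *)
Lemma good_system (I : finType) (c : I -> F) (e : I -> nat) (f h : rat -> F)
    (k1 : I) (B : rat) :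
  (forall l, 0 <= l -> f l = 0) -> (forall l, l < - B -> f l = 0) ->
  good p h -> c k1 != 0 ->
  (forall k, k != k1 -> c k != 0 -> (e k < e k1)%N) ->
  (forall l, \sum_k c k * f (l / p%:R ^+ e k) = h l) -> good p f.
Proof.
move=> f0 fB gh ck1 emax fE a; have [D D0 [m aE]] := rat_fracE a.
have DR : 0 < D%:R :> rat by rewrite ltr0n.
have DN : D%:R != 0 :> rat by rewrite gt_eqF.
set K := e k1 in emax.
(* With this N, the windows at -(t+1)/D with t >= N, once divided by p^j with j <= K, lie below -B,
   where f vanishes. *)
pose N := Num.bound (D%:R * (1 + `|B| * p%:R ^+ K) : rat).
pose G (j : nat) (b : rat) (fs : seq 'I_p) : F := f ((b + frac_val fs) / p%:R ^+ j).
pose g (k : 'I_K.+1 * 'I_N) := G k.1 (- (k.2.+1)%:R / D%:R).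
have gP (l : int) j : (j <= K)%N -> span_mod g (G j (l%:~R / D%:R)).
  move=> jK; case: l => t.
    apply: span_mod_ext (span_mod0 g) => fs; rewrite /G f0 //.
    rewrite divr_ge0 ?addr_ge0 ?divr_ge0 ?frac_val_ge0 ?ler0n ?exprn_ge0 ?ler0n //.
  have [tN|tN] := ltnP t N.
    have jK' : (j < K.+1)%N by [].
    by apply: span_mod_ext (span_mod_gen g (Ordinal jK', Ordinal tN)).
  apply: span_mod_ext (span_mod0 g) => fs; rewrite /G fB //.
  rewrite ltr_pdivrMr ?pX_gt0 //.
  have Nb : D%:R * (1 + `|B| * p%:R ^+ K) < t.+1%:R :> rat.
    apply: lt_le_trans (_ : N%:R <= _); last by rewrite ler_nat ltnW.
    have := archi_boundP (_ : 0 <= D%:R * (1 + `|B| * p%:R ^+ K) :> rat); apply.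
    by rewrite mulr_ge0 ?addr_ge0 ?mulr_ge0 ?ler0n ?exprn_ge0 ?ler0n.
  have Bj : B * p%:R ^+ j <= `|B| * p%:R ^+ K.
    apply: le_trans (_ : `|B| * p%:R ^+ j <= _).
      by rewrite ler_wpM2r ?ler_norm // ltW ?pX_gt0.
    by rewrite ler_wpM2l // ler_weXn2l // ler1n ltnW.
  have : t.+1%:R / D%:R > 1 + B * p%:R ^+ j.
    rewrite ltr_pdivlMr //; apply: le_lt_trans Nb.
    by rewrite mulrC ler_pM2l // lerD2l.
  have := frac_val_lt1 p_gt1 fs.
  have -> : (Negz t)%:~R / D%:R = - (t.+1%:R / D%:R) :> rat.
    by rewrite NegzE mulrNz mulNr.
  lra.
have GE j b (d : 'I_p) fs : G j b (d :: fs) = G j.+1 (p%:R * b + d%:R) fs.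
  rewrite /G /=; congr f; have := pR_neq0 p_gt1; have := pX_neq0 p_gt1 j => *.
  rewrite exprS; field; by apply/andP.
have bE (l : int) (d : 'I_p) : p%:R * (l%:~R / D%:R) + d%:R
    = (p%:Z * l + d%:Z * D%:Z)%:~R / D%:R :> rat.
  by rewrite rmorphD !rmorphM /= -!pmulrn; field.
apply: (@recognizable_ext _ _ (G 0%N a)).
  by move=> fs; rewrite /G expr0 divr1.
rewrite aE; apply: (@span_mod_closed_recognizable _ _ _ g) (gP m _ (leq0n _)).
move=> [j t] d; rewrite /g /=.
have -> : - t.+1%:R / D%:R = (- t.+1%:Z)%:~R / D%:R :> rat.
  by rewrite mulrNz.
have [jK|Kj] := ltnP j K.
  apply: (@span_mod_ext _ _ _ _ (G j.+1 (p%:R * ((- t.+1%:Z)%:~R / D%:R) + d%:R))).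
    by move=> fs; rewrite GE.
  by rewrite bE; apply: gP.
have {Kj} jK : nat_of_ord j = K.
  by apply/eqP; rewrite eqn_leq Kj andbT -ltnS ltn_ord.
rewrite jK; set b := _ / D%:R.
apply: (@span_mod_ext _ _ _ _ (fun fs => (c k1)^-1 *
    (h (b + frac_val (d :: fs)) + \sum_(k | k != k1) - c k * G (e k) b (d :: fs)))).
  move=> fs; rewrite /G -fE (bigD1 k1) //= -addrA -big_split big1 ?addr0.
    by rewrite mulKf.
  by move=> k _ /=; rewrite mulNr subrr.
apply/span_modZ/span_modD.
  exact/span_mod_recognizable/(recognizable_cons d (gh b)).
apply: span_mod_sum => k kk1; have [->|ck] := eqVneq (c k) 0.
  by apply: span_mod_ext (span_mod0 g) => fs; rewrite oppr0 mul0r.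
apply: span_modZ; apply: (@span_mod_ext _ _ _ _ (G (e k).+1 (p%:R * b + d%:R))).
  by move=> fs; rewrite GE.
by rewrite bE; apply: gP; apply: emax.
Qed.

End GoodSystem.

(** * Well-ordered solutions of Frobenius equations *)

Section WellOrderedSolution.
Variables (F : fieldType) (p : nat).
Hypothesis p_gt1 : (1 < p)%N.
Variables (I : finType) (c : I -> F) (e j : I -> nat) (Y : rat -> F).
Hypothesis ej_inj : forall k l, c k != 0 -> c l != 0 -> j k = j l -> e k = e l -> k = l.
Hypothesis c_neq0 : exists k, c k != 0.
Hypothesis relY : forall i, \sum_k c k * Y ((i - (e k)%:R) / p%:R ^+ j k) = 0.
Hypothesis woY : well_ordered [set i | Y i != 0].

(** [L k a] is the exponent at which term k of [relY] evaluates Y at a. The lower envelope of these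
    lines plays the role of the Newton polygon. *)
Let L k (a : rat) : rat := (e k)%:R + p%:R ^+ j k * a.
Let below (a i : rat) : F := if i < a then Y i else 0.

Lemma wo_lbound : exists B, forall i, i < B -> Y i = 0.
Proof.
have [ne|ne] := pselect ([set i | Y i != 0] !=set0).
  have [B _ lB] := woY (@subset_refl _ _) ne.
  exists B => i iB; apply/eqP; apply: contraTT iB => Yi.
  by rewrite -leNgt; apply: lB.
exists 0 => i _; apply/eqP; apply: contra_notT ne => Yi.
by exists i.
Qed.

(* With f l the truncation of Y at a, evaluated at a + l, the terms attaining the
   minimum mu are the values f (l / p^(j k)), and the other ones only depend on Y at
   exponents below (mu - e k) / p^(j k) < a. *)
Lemma good_below_step a mu :
  (forall k, c k != 0 -> mu <= L k a) ->
  (exists2 k, c k != 0 & L k a = mu) ->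
  (forall k, c k != 0 -> mu < L k a ->
     good p (below ((mu - (e k)%:R) / p%:R ^+ j k))) ->
  good p (below a).
Proof.
move=> mu_le [k0 ck0 mu_eq] gb.
pose f l := below a (a + l).
suff gf : good p f.
  by apply: good_ext (good_shift (- a) gf) => i; rewrite /f addrC subrK.
pose dom k := (c k != 0) && (L k a == mu).
have dom0 : dom k0 by rewrite /dom ck0 mu_eq eqxx.
(* Lines through a common point with equal slopes coincide, so by [ej_inj] the largest j is attained
   only once. *)
case: (arg_maxnP j dom0) => k1 /andP[ck1 /eqP mu1] k1max.
have [B YB] := wo_lbound.
pose b k := (mu - (e k)%:R) / p%:R ^+ j k.
pose h l := \sum_(k | (c k != 0) && (mu < L k a))
  - c k * below (b k) (l / p%:R ^+ j k + b k).
apply: (@good_system _ _ p_gt1 I (fun k => if dom k then c k else 0) j f h k1 (a - B)).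
- by move=> l l0; rewrite /f /below ifF //; apply/negbTE; rewrite -leNgt lerDl.
- move=> l lB; rewrite /f /below YB; last by lra.
  by rewrite if_same.
- apply: good_sum => k /andP[ck muk].
  exact/goodZ/(@good_divX _ _ p_gt1 _ (fun i => below (b k) (i + b k)))/good_shift/gb.
- by rewrite /dom ck1 mu1 eqxx.
- move=> k kk1; case: ifP => [dk _|_]; last by rewrite eqxx.
  have := k1max k dk; rewrite /= leq_eqVlt => /predU1P[jj|//].
  case/negP: kk1; apply/eqP; case/andP: dk => ck /eqP Lk.
  apply: ej_inj => //; apply/eqP; rewrite -(eqr_nat rat); apply/eqP.
  by move: Lk; rewrite -mu1 /L jj => /addIr.
(* For l >= 0 both sides vanish by truncation; for l < 0 the equation is [relY] at mu + l. *)
move=> l; have [l0|l0] := leP 0 l.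
  rewrite big1 => [|k _].
    rewrite /h big1 // => k _; rewrite /below ifF ?mulr0 //.
    by apply/negbTE; rewrite -leNgt lerDr divr_ge0 // ltW ?pX_gt0.
  rewrite /f /below [X in _ * X]ifF ?mulr0 //.
  by apply/negbTE; rewrite -leNgt lerDl divr_ge0 // ltW ?pX_gt0.
have lj k : l / p%:R ^+ j k < 0 by rewrite pmulr_llt0 ?invr_gt0 ?pX_gt0.
rewrite /h [RHS]big_mkcond; apply/eqP; rewrite -subr_eq0 -sumrB; apply/eqP.
rewrite -[RHS](relY (mu + l)); apply: eq_bigr => k _.
have [c0|ck] := eqVneq (c k) 0; first by rewrite c0 !mul0r if_same mul0r subr0.
have := mu_le k ck; rewrite le_eqVlt => /predU1P[mk|mk].
  rewrite /dom ck -mk eqxx ltxx /= subr0; congr (_ * _).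
  rewrite /f /below gtrDl lj; congr Y.
  rewrite mk /L; field; exact: pX_neq0.
rewrite /dom ck gt_eqF //= mk /= mul0r sub0r mulNr opprK; congr (_ * _).
rewrite /below gtrDr lj; congr Y.
rewrite /b; field; exact: pX_neq0.
Qed.

(* Quantifying over all b <= a makes reach downward closed without having to prove
   that truncations of good functions are good. *)
Let reach a := forall b, b <= a -> good p (below b).

Lemma reach_le a b : b <= a -> reach a -> reach b.
Proof. by move=> ba ra x xb; apply: ra; apply: le_trans ba. Qed.

Lemma reach_lt a b : reach a -> ~ reach b -> a < b.
Proof. by move=> ra rb; rewrite ltNge; apply/negP => /reach_le /(_ ra). Qed.

(** [below b] changes only when b passes a support exponent. Up to the first one beyond a, it
    differs from [below a] by at most a multiple of a [good_delta] term. *)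
Lemma reach_next a : reach a ->
  (forall b, good p (below b)) \/ exists2 b, a < b & reach b.
Proof.
move=> ra.
have key b : (forall i, a < i -> i < b -> Y i = 0) -> good p (below b).
  move=> Yab; have [/ra//|ab] := leP b a.
  have := goodD (ra a (lexx a)) (goodZ (Y a) (@good_delta F p p_gt1 a)).
  apply: good_ext => i; rewrite /below; have [ia|ai|->] := ltgtP i a.
  - by rewrite (lt_trans ia ab) mulr0 addr0.
  - by rewrite mulr0 addr0; case: ifP => // ib; rewrite Yab.
  - by rewrite ab mulr1 add0r.
have [ne|ne] := pselect ([set i | a < i /\ Y i != 0] !=set0).
  right; have [|b [ab Yb] lb] := woY _ ne; first by move=> i [].
  exists b => // x xb; apply: key => i ai ix; apply/eqP; apply: contraTT ix => Yi.
  by rewrite -leNgt; apply: le_trans xb _; apply: lb.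
left=> b; apply: key => i ai _; apply/eqP; apply: contra_notT ne => Yi.
by exists i.
Qed.

(** Each point of s in turn pushes the endpoint on its side of the cut inwards, so that the open
    interval left contains none of them. *)
Lemma reach_cut (s : seq rat) : (exists a, reach a) -> (exists a, ~ reach a) ->
  exists a0 a1, [/\ reach a0, ~ reach a1 & forall x, x \in s -> x <= a0 \/ a1 <= x].
Proof.
move=> [a0 r0] [a1 r1]; elim: s => [|x s [b0 [b1 [q0 q1 H]]]].
  by exists a0, a1.
have [rx|rx] := pselect (reach x).
  exists (Num.max b0 x), b1; split => //; first by case: leP.
  move=> y; rewrite inE => /predU1P[->|/H[|]]; last by right.
    by left; rewrite le_max lexx orbT.
  by left; rewrite le_max; apply/orP; left.
exists b0, (Num.min b1 x); split => //; first by case: leP.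
move=> y; rewrite inE => /predU1P[->|/H[|]]; first by right; rewrite ge_min lexx orbT.
  by left.
by right; rewrite ge_min; apply/orP; left.
Qed.

Lemma pos_lower_bound (P : pred I) (u : I -> rat) :
  (forall k, P k -> 0 < u k) -> exists2 x, 0 < x & forall k, P k -> x <= u k.
Proof.
move=> u0; have [[k0 Pk0]|nP] := pselect (exists k, P k); last first.
  by exists 1 => // k Pk; case: nP; exists k.
case: (arg_minP u Pk0) => k1 Pk1 H; exists (u k1) => //; exact: u0.
Qed.

Lemma affine_ge (A B m x y z : rat) : x <= y -> y <= z ->
  m <= A + B * x -> m <= A + B * z -> m <= A + B * y.
Proof. by move=> xy yz mx mz; have [B0|B0] := leP 0 B; nra. Qed.

Lemma good_below a : good p (below a).
Proof.
apply: contrapT => nga.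
have nreach : exists a, ~ reach a by exists a => /(_ a (lexx a)).
have [B YB] := wo_lbound.
have reachB : exists a, reach a.
  exists B => b bB; apply: good_ext (@good0 F p) => i; rewrite /below.
  by case: ifP => // ib; rewrite YB // (lt_le_trans ib).
(* s contains the slopes, i.e. the points where two of the lines L k cross *)
pose s : seq rat := [seq ((e k)%:R - (e l)%:R) / (p%:R ^+ j l - p%:R ^+ j k)
  | k <- enum I, l <- enum I].
have [a0 [a1 [r0 r1 sP]]] := reach_cut s reachB nreach.
have lead b : exists2 k0, c k0 != 0 & forall k, c k != 0 -> L k0 b <= L k b.
  have [k Pk] := c_neq0.
  case: (arg_minP (fun k => L k b) (Pk : (fun k => c k != 0) k)) => k0 ck0 H.
  by exists k0.
(* If every threshold below a1 is reached, one step at a1 suffices: the terms off the minimum only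
   involve thresholds strictly below a1. *)
have [min1|nmin] := pselect (forall b, b < a1 -> reach b).
  apply: r1 => b; rewrite le_eqVlt => /predU1P[->|/min1/(_ _ (lexx _))//].
  have [k0 ck0 H] := lead a1.
  apply: (@good_below_step a1 (L k0 a1)) => //; first by exists k0.
  move=> k ck lt; apply: (min1 _ _ _ (lexx _)).
  by rewrite ltr_pdivrMr ?pX_gt0 // mulrC; move: lt; rewrite {2}/L; lra.
(* Otherwise a single line is lowest on [a3, a2], by a margin that gives a uniform eps. *)
have {nmin} [a2 a21 r2] : exists2 b, b < a1 & ~ reach b.
  apply: contrapT => H; apply: nmin => b ba; apply: contrapT => rb.
  by apply: H; exists b.
(* A crossing may lie at a0 itself. Passing to a3 > a0 keeps the lowest line apart from the others
   on the closed interval [a3, a2]. *)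
have [all_good|[a3 a03 r3]] := reach_next r0; first by case: nga; apply: all_good.
have a32 := reach_lt r3 r2.
have [k0 ck0 lead2] := lead a2.
have gap k : (k != k0) && (c k != 0) -> L k0 a3 < L k a3 /\ L k0 a2 < L k a2.
  move=> /andP[kk0 ck]; have := lead2 k ck; rewrite /L.
  have [jj|jj] := eqVneq (j k) (j k0).
    have ee : e k != e k0 by apply: contra kk0 => /eqP ee; apply/eqP/ej_inj.
    by rewrite jj !lerD2r !ltrD2r ler_nat ltr_nat ltn_neqAle eq_sym ee => ->.
  have pjj : p%:R ^+ j k - p%:R ^+ j k0 != 0 :> rat.
    by rewrite subr_eq0 -!natrX eqr_nat eqn_exp2l.
  (* The two lines cross at x, which by [sP] is not strictly between a0 and a1, so their difference
     has the same sign at a3 and at a2. *)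
  pose x : rat := ((e k0)%:R - (e k)%:R) / (p%:R ^+ j k - p%:R ^+ j k0).
  have xE : (e k)%:R = (e k0)%:R - (p%:R ^+ j k - p%:R ^+ j k0) * x.
    by rewrite /x mulrC divfK //; ring.
  have /sP : x \in s by apply/allpairsP; exists (k0, k); rewrite !mem_enum.
  rewrite xE; move: pjj; set P := p%:R ^+ j k; set P0 := p%:R ^+ j k0.
  move=> pjj xx le2; have le2' : 0 <= (P - P0) * (a2 - x) by lra.
  suff [H1 H2] : 0 < (P - P0) * (a3 - x) /\ 0 < (P - P0) * (a2 - x) by split; lra.
  case: xx => xa; have [P1|P1|P1] := ltgtP (P - P0) 0.
  - by have : 0 < (P0 - P) * (a2 - x); [apply: mulr_gt0; lra|lra].
  - by split; apply: mulr_gt0; lra.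
  - by rewrite P1 eqxx in pjj.
  - have H1 : 0 < (P0 - P) * (x - a3) by apply: mulr_gt0; lra.
    have H2 : 0 < (P0 - P) * (x - a2) by apply: mulr_gt0; lra.
    by split; lra.
  - by have : 0 < (P - P0) * (x - a2); [apply: mulr_gt0; lra|lra].
  - by rewrite P1 eqxx in pjj.
have [eps eps0 epsP] := @pos_lower_bound (fun k => (k != k0) && (c k != 0))
  (fun k => Num.min (L k a3 - L k0 a3) (L k a2 - L k0 a2) / p%:R ^+ j k)
  (fun k kP => ltac:(by rewrite divr_gt0 ?pX_gt0 // lt_min !subr_gt0; apply/andP/gap)).
have gapb k b : k != k0 -> c k != 0 -> a3 <= b -> b <= a2 ->
    eps * p%:R ^+ j k <= L k b - L k0 b.
  move=> kk0 ck ab ba; have := epsP k; rewrite kk0 ck => /(_ isT).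
  rewrite ler_pdivlMr ?pX_gt0 // le_min => /andP[e3 e2].
  have := @affine_ge ((e k)%:R - (e k0)%:R) (p%:R ^+ j k - p%:R ^+ j k0) _ _ _ _ ab ba.
  move: e3 e2; rewrite /L => e3 e2 /(_ (eps * p%:R ^+ j k)) H.
  by have := H ltac:(lra) ltac:(lra); lra.
(* Let n + 1 be the least number of steps of length eps from a2 down to a reached threshold. For b
   <= a2 - n eps above a3, [good_below_step] needs only thresholds at most b - eps, so a2 - n eps is
   reached too. *)
have exn : exists n : nat, `[< reach (a2 - n%:R * eps) >].
  exists (Num.bound ((a2 - a3) / eps)); apply/asboolP; apply: reach_le r3.
  have : (a2 - a3) / eps < (Num.bound ((a2 - a3) / eps))%:R.
    by apply: archi_boundP; rewrite divr_ge0 ?subr_ge0 ?ltW.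
  by rewrite ltr_pdivrMr //; lra.
case: (ex_minnP exn) => -[|n] /asboolP rn nmin.
  by apply: r2; move: rn; rewrite mul0r subr0.
have rn' : ~ reach (a2 - n%:R * eps).
  by move=> /asboolP /nmin; rewrite ltnn.
apply: rn' => b bn; apply: contrapT => ngb.
have ab : a3 < b by apply: (reach_lt r3) => /(_ _ (lexx b)).
have ba : b <= a2.
  by apply: le_trans bn _; rewrite gerBl mulr_ge0 // ltW.
apply: ngb; apply: (@good_below_step b (L k0 b)); last 1 first.
- move=> k ck lt; have kk0 : k != k0 by apply: contraTneq lt => ->; rewrite ltxx.
  apply: rn; rewrite ler_pdivrMr ?pX_gt0 //.
  have := gapb k b kk0 ck (ltW ab) ba.
  have : b * p%:R ^+ j k <= (a2 - n%:R * eps) * p%:R ^+ j k.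
    by rewrite ler_wpM2r // ltW ?pX_gt0.
  by rewrite -natr1 /L; lra.
- move=> k ck; have [->//|kk0] := eqVneq k k0.
  rewrite -subr_ge0; apply: le_trans (gapb k b kk0 ck (ltW ab) ba).
  by rewrite mulr_ge0 // ltW ?pX_gt0.
by exists k0.
Qed.

Lemma good_solution : good p Y.
Proof.
move=> a; apply: recognizable_ext (good_below (a + 1) a) => fs.
by rewrite /below ltrD2l frac_val_lt1.
Qed.

End WellOrderedSolution.

(** * Integer digits and automata *)

Section Regular.
Variables (F : finFieldType) (p : nat).
Hypothesis p_gt1 : (1 < p)%N.

(* Leading zeros of ds and trailing zeros of fs are allowed. *)
Definition regular (f : rat -> F) : Prop :=
  exists (S : finType) (s0 : S) (step : S -> 'I_p -> S) (out : S -> seq 'I_p -> F),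
    (forall s, recognizable (out s)) /\
    forall ds fs, f ((digits_val ds)%:R + frac_val fs) = out (foldl step s0 ds) fs.

(** Multiplication by p moves the first fractional digit to the integer part; an empty fractional
    part supplies the digit 0. *)
Lemma regular_scale f : regular f -> regular (fun i => f (p%:R * i)).
Proof.
move=> [S [s0 [step [out [ro fE]]]]].
have p0 : (0 < p)%N by apply: ltnW.
exists S, s0, step, (fun s fs => if fs is d :: fs' then out (step s d) fs'
   else out (step s (Ordinal p0)) [::]); split.
  by move=> s; apply: recognizable_uncons => d; apply: ro.
move=> ds [|d fs].
  rewrite -foldl_rcons -fE digits_val_rcons natrD natrM mulr0n.
  by rewrite !addr0 mulrC.
rewrite -foldl_rcons -fE digits_val_rcons natrD natrM /=; congr f.
have := pR_neq0 p_gt1 => p0'; by field.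
Qed.

Lemma regular_scaleX n f : regular f -> regular (fun i => f (p%:R ^+ n * i)).
Proof.
elim: n f => [|n IH] f rf.
  by rewrite (_ : (fun i => _) = f) //; apply: funext => i; rewrite mul1r.
have := IH _ (regular_scale rf); congr regular.
by apply: funext => i; rewrite exprS mulrA.
Qed.

(* The state reached after the integer digits of n expresses the windows of
   i |-> Y (i / p^j) at n, n - 1, ..., n - W, for j <= J, as linear combinations of
   the fixed functions word_mulmx A w. *)
Lemma regular_contraction (I : finType) (c : I -> F) (e j : I -> nat) (Y : rat -> F)
    (L : nat) (a : nat -> F) :
  (forall k, 0 < j k)%N ->
  (forall i, Y i = \sum_k c k * Y ((i - (e k)%:R) / p%:R ^+ j k)) ->
  good p Y -> regular (fun i => \sum_(t < L) a t * Y (i - t%:R)).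
Proof.
move=> j0 relY gY.
(* Expanding by [relY] produces offsets up to W + E. Since E <= W and 2 <= p, the carry brings them
   back to at most W; L accounts for the shifts t < L. *)
pose J := \max_k j k; pose E := \max_k e k; pose W := (E + L)%N.
have jJ k : (j k <= J)%N by apply: leq_bigmax.
have eE k : (e k <= E)%N by apply: leq_bigmax.
have [n [A [w [v vP]]]] := @recognizable_family F p ('I_J.+1 * 'I_W.+1)%type
  (fun r fs => Y ((- r.2%:R + frac_val fs) / p%:R ^+ r.1))
  (fun r => @good_divX F p p_gt1 r.1 Y gY (- r.2%:R)).
pose T := {ffun 'I_J.+1 * 'I_W.+1 -> 'rV[F]_n}.
(* d - i = r - p * (carry d i %/ p) with the digit r = p - 1 - carry d i %% p *)
pose carry (d : 'I_p) i := (i + (p.-1 - d))%N.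
pose aux (V : T) (d : 'I_p) jj i : 'rV[F]_n :=
  V (inord jj.-1, inord (carry d i %/ p)) *m A (insubd d (p.-1 - carry d i %% p)%N).
(* Reading an integer digit consumes one division by p. At j = 0 none is left, and [relY] first
   replaces Y by terms with j k > 0. *)
pose step (V : T) d : T := [ffun r : 'I_J.+1 * 'I_W.+1 => if r.1 == ord0
  then \sum_k c k *: aux V d (j k) (r.2 + e k)%N else aux V d r.1 r.2].
pose inv (V : T) (m : nat) := forall jj i, (jj <= J)%N -> (i <= W)%N -> forall fs,
  Y ((m%:R - i%:R + frac_val fs) / p%:R ^+ jj)
    = (V (inord jj, inord i) *m word_mulmx A w fs) 0 0.
have auxP V m (d : 'I_p) jj i fs : inv V m ->
    (0 < jj)%N -> (jj <= J)%N -> (i <= W + E)%N ->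
    Y (((m * p + d)%:R - i%:R + frac_val fs) / p%:R ^+ jj)
      = (aux V d jj i *m word_mulmx A w fs) 0 0.
  move=> iV jj0 jjJ iW; have dp := ltn_ord d.
  have p0 : (0 < p)%N by apply: ltnW.
  have cW : (carry d i %/ p <= W)%N.
    suff : (carry d i %/ p < W.+1)%N by [].
    by rewrite ltn_divLR // /carry; move: iW; rewrite /W; nia.
  rewrite /aux -mulmxA.
  set r' := insubd _ _.
  have := iV jj.-1 _ (leq_trans (leq_pred _) jjJ) cW (r' :: fs).
  rewrite /= => <-; congr Y.
  have r'E : (r' : nat) = (p.-1 - carry d i %% p)%N.
    by rewrite /r' val_insubd ifT //; lia.
  have := divn_eq (carry d i) p; have := ltn_pmod (carry d i) p0.
  set q' := (_ %/ p)%N; set rr := (_ %% p)%N in r'E *; rewrite {1}/carry => rrp qE.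
  have key : (d + p * q' = r' + i)%N by rewrite r'E; lia.
  have : d%:R + p%:R * q'%:R = r'%:R + i%:R :> rat by rewrite -natrM -!natrD key.
  rewrite natrD natrM => H.
  have -> : d%:R = r'%:R + i%:R - p%:R * q'%:R :> rat by lra.
  rewrite -{1}(prednK jj0) exprS; have := pR_neq0 p_gt1; have := pX_neq0 p_gt1 jj.-1 => *.
  by field; apply/andP.
have stepP V m (d : 'I_p) : inv V m -> inv (step V d) (m * p + d)%N.
  move=> iV jj i jjJ iW fs; rewrite ffunE /=.
  rewrite -val_eqE /= !inordK ?ltnS //; case: eqP => [->|/eqP jj0]; last first.
    by apply: auxP; rewrite // ?lt0n //; lia.
  rewrite expr0 divr1 relY mulmx_suml summxE; apply: eq_bigr => k _.
  rewrite -scalemxAl mxE -(auxP _ m) //; last by have := eE k; lia.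
  by congr (_ * Y (_ / _)); rewrite [in RHS]natrD; ring.
pose V0 : T := [ffun r => v r].
have inv0 : inv V0 0%N.
  move=> jj i jjJ iW fs; rewrite ffunE -vP /= sub0r.
  by rewrite !inordK.
have invds ds : inv (foldl step V0 ds) (digits_val ds).
  elim/last_ind: ds => [|ds d IH]; first exact: inv0.
  by rewrite foldl_rcons digits_val_rcons; apply: stepP.
exists T, V0, step, (fun (V : T) fs =>
  \sum_(t < L) a t * (V (inord 0, inord t) *m word_mulmx A w fs) 0 0).
split=> [V|ds fs].
  by apply: recognizable_sum => t; exists n, A, w, (V (inord 0, inord t)).
apply: eq_bigr => t _; congr (_ * _).
have tW : (t <= W)%N by have := ltn_ord t; rewrite /W; lia.
have := invds ds 0%N t (leq0n _) tW fs.
by rewrite expr0 divr1 addrAC => ->.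
Qed.

End Regular.

(** * Regular functions and automata *)

Section AutomaticRegular.
Variables (F : finFieldType) (p : nat).
Hypothesis p_gt1 : (1 < p)%N.
Variable x : genseries F.

(** Before the radix point the state is that of the integer digits; after it, a row vector, of which
    there are finitely many since F is finite. *)
Lemma regular_automatic : gsupp x `<=` Zinvp p -> regular p x -> automatic p x.
Proof.
move=> hx [S [s0 [step [out [/recognizable_family[n [A [w [v vP]]]] xE]]]]].
split=> //.
pose tr (a : symbol p) (s : (S + 'rV[F]_n)%type) : (S + 'rV[F]_n)%type :=
  match a, s with
  | Some d, inl s => inl (step s d)
  | Some d, inr u => inr (u *m A d)
  | None, inl s => inr (v s)
  | None, inr u => inr u
  end.
pose o (s : (S + 'rV[F]_n)%type) : F :=
  match s with inl s => (v s *m w) 0 0 | inr u => (u *m w) 0 0 end.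
exists (@Automaton _ _ (S + 'rV[F]_n)%type (inl s0) o tr) => i _ _ _ [ds [fs [_ _ -> ->]]].
rewrite -frac_valE // xE vP /run /=.
have rds s es : foldl (fun s a => tr a s) (inl s) (map Some es) = inl (foldl step s es).
  by elim: es s => //= d es IH s.
have rfs u es : o (foldl (fun s a => tr a s) (inr u) (map Some es))
    = (u *m word_mulmx A w es) 0 0.
  elim: es u => //= d es IH u; by rewrite IH mulmxA.
case: fs => [|f fs]; first by rewrite /radix_string rds.
by rewrite /radix_string foldl_cat rds [foldl _ _ (_ :: _)]/= rfs mulmxA.
Qed.

Implicit Types ds fs : seq 'I_p.

Fixpoint strip_zeros fs : seq 'I_p :=
  if fs is d :: fs' then
    if nilp (strip_zeros fs') && (d == 0%N :> nat) then [::] else d :: strip_zeros fs'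
  else [::].

Lemma frac_val_strip_zeros fs : frac_val (strip_zeros fs) = frac_val fs.
Proof.
elim: fs => //= d fs IH; case: ifP => [/andP[/nilP s0 /eqP ->]|_] /=; last by rewrite IH.
by rewrite -IH s0 /= addr0 mul0r.
Qed.

Lemma frac_part_ok_strip_zeros fs : frac_part_ok (strip_zeros fs).
Proof.
elim: fs => //= d fs IH; case: ifP => // dfs; move: dfs IH; rewrite /frac_part_ok.
by case: (strip_zeros fs) => [|f s] //= dz _; rewrite lt0n dz.
Qed.

(** M is specified on canonical representations only, whereas [regular] admits padded ones. Leading
    zeros are withheld from M by an extra state; trailing zeros are handled inside the recognizable
    functions. *)
Lemma automatic_regular : automatic p x -> regular p x.
Proof.
move=> [_ [M MP]]; have p0 : (0 < p)%N by apply: ltnW.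
pose tr u (a : symbol p) := @trans _ _ M a u.
(* [None] means that no nonzero digit was read so far; at the end u0, the state of M after the
   integer part 0, stands in for it. *)
pose step (s : option (state M)) (d : 'I_p) : option (state M) :=
  if s is Some u then Some (tr u (Some d))
  else if d == 0%N :> nat then None else Some (tr (init M) (Some d)).
pose u0 := tr (init M) (Some (Ordinal p0)).
pose read fs u := foldl tr u (map Some fs).
pose out s fs := let u := odflt u0 s in let t := strip_zeros fs in
  if nilp t then output u else output (read t (tr u None)).
exists (option (state M)), None, step, out; split.
  (* Whether a zero is stripped depends on what follows it. Adding [g None], the indicator of
     all-zero strings, makes the span stable under digit quotients. *)
  pose g s fs : F := if s is Some u then
      if nilp (strip_zeros fs) then 0 else output (read (strip_zeros fs) u)
    else (nilp (strip_zeros fs))%:R.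
  have gP s : recognizable (g s).
    apply: span_mod_closed_recognizable (span_mod_gen g s) => {s} -[u|] d.
      apply: span_mod_ext (span_modD (span_mod_gen g (Some (tr u (Some d))))
        (span_modZ (if d == 0%N :> nat then 0 else output (tr u (Some d)))
          (span_mod_gen g None))) => fs /=.
      case: (strip_zeros fs) => [|f s] /=; last by rewrite mulr0 addr0.
      by rewrite mulr1 add0r; case: ifP.
    apply: span_mod_ext (span_modZ (d == 0%N :> nat)%:R (span_mod_gen g None)) => fs /=.
    by case: (strip_zeros fs) => [|f s] /=; case: eqP => //=; rewrite ?mulr1 ?mulr0.
  move=> s; apply: recognizable_ext (recognizableD (gP (Some (tr (odflt u0 s) None)))
    (recognizableZ (output (odflt u0 s)) (gP None))) => fs.
  by rewrite /out /=; case: ifP => _; rewrite ?mulr1 ?mulr0 ?add0r ?addr0.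
have stepP ds : match foldl step None ds return Prop with
    | None => digits_val ds = 0%N
    | Some u => exists ds', [/\ (0 < head 0 [seq val d | d <- ds'])%N,
        digits_val ds' = digits_val ds & read ds' (init M) = u]
    end.
  elim/last_ind: ds => // ds d; rewrite foldl_rcons digits_val_rcons.
  case: (foldl step None ds) => [u [ds' [h0 v0 ru]]|->] /=.
    exists (rcons ds' d); split.
    - by case: ds' h0 {v0 ru}.
    - by rewrite digits_val_rcons v0.
    - by rewrite /read map_rcons foldl_rcons -ru.
  case: eqP => [->//|/eqP d0]; exists [:: d]; split=> //=.
  by rewrite lt0n.
move=> ds fs; set i := _ + _.
have [ds' [ok vds' rds']] : exists ds', [/\ int_part_ok ds',
    digits_val ds' = digits_val ds & read ds' (init M) = odflt u0 (foldl step None ds)].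
  move: (stepP ds); case: (foldl step None ds) => [u [ds' [h0 v0 ru]]|v0].
    by exists ds'; split=> //; rewrite /int_part_ok h0 orbT.
  by exists [:: Ordinal p0]; split=> //; rewrite v0.
have iE : i = (digits_val (ds ++ fs))%:R / p%:R ^+ size fs.
  by have := shift_radix p_gt1 ds [::] fs; rewrite addr0 cats0 => ->.
rewrite -(MP i _ _ (radix_string ds' (strip_zeros fs))).
- rewrite /run /out /radix_string -rds'.
  case: (strip_zeros fs) => [|f s] //=.
  by rewrite foldl_cat.
- by rewrite addr_ge0 ?ler0n ?frac_val_ge0.
- by exists (Posz (digits_val (ds ++ fs))), (size fs).
exists ds', (strip_zeros fs); split=> //; first exact: frac_part_ok_strip_zeros.
by rewrite vds' -frac_valE // frac_val_strip_zeros.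
Qed.

End AutomaticRegular.

(** * Generalized power series *)

Section GenSeriesFacts.
Variable F : fieldType.
Implicit Types x y z : genseries F.

Lemma gs_poly_mulE (P : {poly F}) y k N : (size P <= N)%N ->
  (gs_of_poly P * y) k = \sum_(e < N) P`_e * y (k - e%:R).
Proof.
move=> PN; rewrite gsME -/(gs_conv _ _ _).
rewrite (@gs_convE _ _ _ _ [seq m%:R | m <- iota 0 N]).
- rewrite big_map (_ : iota 0 N = index_iota 0 N) ?big_mkord; last first.
    by rewrite /index_iota subn0.
  by apply: eq_bigr => e _; rewrite gs_of_poly_nat.
- by rewrite map_inj_uniq ?iota_uniq // => a b /eqP; rewrite eqr_nat => /eqP.
move=> i Pi _; have [/natrP[m im]|ni] := boolP (i \is a Num.nat); last first.
  by move: Pi; rewrite /gsupp /mkset gs_of_poly_nnat ?eqxx.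
apply/mapP; exists m => //; rewrite mem_iota /= add0n.
rewrite ltnNge; apply: contraT => /negPn Nm; move: Pi.
by rewrite /gsupp /mkset im gs_of_poly_nat nth_default ?eqxx // (leq_trans PN).
Qed.

Lemma gs_mul_supp x y k : (x * y) k != 0 ->
  exists i j, [/\ x i != 0, y j != 0 & k = i + j].
Proof. by move=> /gs_conv_supp[i xi [j yj <-]]; exists i, j. Qed.

Lemma gs_mul1E x y a b : (forall i, x i != 0 -> i = a) ->
  (x * y) (a + b) = x a * y b.
Proof.
move=> xa; rewrite gsME -/(gs_conv _ _ _) (@gs_convE _ _ _ _ [:: a]) //.
  by rewrite big_seq1 [a + b]addrC addrK.
by move=> i /xa -> _; rewrite inE.
Qed.

Lemma gs_restrict_pred x (P : pred rat) : gs_pred (fun i => if P i then x i else 0).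
Proof.
have S : [set i | (if P i then x i else 0) != 0] `<=` gsupp x.
  by move=> i /=; case: ifP; rewrite ?eqxx.
apply/asboolP; split; last exact: well_orderedS S (@gsupp_wo _ x).
by move=> i /S /gsupp_ge0.
Qed.

Definition gs_restrict x P := GenSeries (gs_restrict_pred x P).

Lemma gs_exp_supp_lt y a n : (forall i, y i != 0 -> i < a) ->
  forall i, (y ^+ n.+1) i != 0 -> i < n.+1%:R * a.
Proof.
move=> ya; elim: n => [|n IH] i; first by rewrite expr1 mul1r; apply: ya.
rewrite exprS => /gs_mul_supp[k [l [/ya ka /IH la ->]]].
by rewrite -[n.+2%:R]natr1 mulrDl mul1r addrC ltrD.
Qed.

Lemma gs_exp_supp_gt y a n : (forall i, y i != 0 -> a < i) ->
  forall i, (y ^+ n.+1) i != 0 -> n.+1%:R * a < i.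
Proof.
move=> ya; elim: n => [|n IH] i; first by rewrite expr1 mul1r; apply: ya.
rewrite exprS => /gs_mul_supp[k [l [/ya ka /IH la ->]]].
by rewrite -[n.+2%:R]natr1 mulrDl mul1r addrC ltrD.
Qed.

Lemma gs_exp_single y a n : (forall i, y i != 0 -> i = a) ->
  (y ^+ n) (n%:R * a) = y a ^+ n.
Proof.
move=> ya; elim: n => [|n IH]; first by rewrite mul0r expr0 gs1E eqxx.
by rewrite -natr1 mulrDl mul1r exprS addrC gs_mul1E // IH exprS.
Qed.

Lemma pchar_genseries p : p \in [pchar F] -> p \in [pchar (genseries F)].
Proof.
move=> pF; have pr := pcharf_prime pF; apply/andP; split=> //; apply/eqP.
apply: gsP => i; rewrite -(@rmorph_nat _ _ (@gs_of_poly F)).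
have -> : p%:R = 0 :> {poly F} by rewrite -polyC_natr (pcharf0 pF).
by rewrite rmorph0.
Qed.

(* Split x at the exponent i / p^m: the p^m-th power is additive, and the powers
   of the two outer parts have their supports strictly below, resp. above, i. *)
Lemma gs_frobeniusE p m x i : p \in [pchar F] ->
  (x ^+ (p ^ m)) i = x (i / (p ^ m)%:R) ^+ (p ^ m).
Proof.
move=> pF; set n := (p ^ m)%N; have pr := pcharf_prime pF.
have n0 : (0 < n)%N by rewrite expn_gt0 prime_gt0.
have nR : n%:R != 0 :> rat by rewrite pnatr_eq0 -lt0n.
pose a := i / n%:R; have ia : i = n%:R * a by rewrite /a mulrC divfK.
pose y1 := gs_restrict x (fun j => j < a).
pose y2 := gs_restrict x (fun j => j == a).
pose y3 := gs_restrict x (fun j => a < j).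
have xE : x = y1 + (y2 + y3).
  apply: gsP => j; rewrite !gsDE /=.
  by case: ltgtP => _; rewrite ?addr0 ?add0r.
have nn : [pchar (genseries F)].-nat n.
  by rewrite pnatX pnatE //; apply/orP; left; apply: pchar_genseries.
rewrite {1}xE !exprDn_pchar // !gsDE.
have -> : (y1 ^+ n) i = 0.
  apply/eqP; apply: contraT => /=; rewrite -(prednK n0) => /gs_exp_supp_lt H.
  have := H a; rewrite prednK // -ia ltxx; apply.
  by move=> j /=; case: ifP; rewrite ?eqxx.
have -> : (y3 ^+ n) i = 0.
  apply/eqP; apply: contraT => /=; rewrite -(prednK n0) => /gs_exp_supp_gt H.
  have := H a; rewrite prednK // -ia ltxx; apply.
  by move=> j /=; case: ifP; rewrite ?eqxx.
rewrite add0r addr0 ia gs_exp_single /=; last first.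
  by move=> j /=; case: (eqVneq j a) => // _; rewrite eqxx.
by rewrite eqxx [n%:R * a]mulrC mulfK.
Qed.

(** This embeds F[[t]], in which polynomials with nonzero constant term are invertible. *)
Definition gs_of_seq_coef (a : nat -> F) (i : rat) : F :=
  if i \is a Num.nat then a (Num.truncn i) else 0.

Lemma gs_of_seq_pred a : gs_pred (gs_of_seq_coef a).
Proof.
apply/asboolP.
have S i : gs_of_seq_coef a i != 0 -> i \is a Num.nat.
  by rewrite /gs_of_seq_coef; case: ifP; rewrite ?eqxx.
split=> [i /S /natr_ge0//|A sA [b Ab]].
have N j : A j -> exists n : nat, j = n%:R by move=> /sA /S /natrP.
have ex : exists n : nat, `[< A n%:R >].
  by have [n e] := N _ Ab; exists n; apply/asboolP; rewrite -e.
case: (ex_minnP ex) => m /asboolP Am mP; exists m%:R => // j Aj.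
by have [n e] := N _ Aj; rewrite e ler_nat mP //; apply/asboolP; rewrite -e.
Qed.

Definition gs_of_seq a : genseries F := GenSeries (gs_of_seq_pred a).

Lemma gs_of_seq_nat a n : gs_of_seq a n%:R = a n.
Proof. by rewrite /= /gs_of_seq_coef natr_nat natrK. Qed.

Lemma gs_of_seq_nnat a i : i \isn't a Num.nat -> gs_of_seq a i = 0.
Proof. by rewrite /= /gs_of_seq_coef => /negPf ->. Qed.

Lemma gs_poly_inv (u : {poly F}) : u`_0 != 0 -> exists s, gs_of_poly u * s = 1.
Proof.
move=> u0.
pose fix S n : {poly F} := if n is n'.+1 then
  S n' + ((u`_0)^-1 * ((n' == 0%N)%:R - (u * S n')`_n')) *: 'X^n' else 0.
pose a n := (S n.+1)`_n.
have Sge n k : (n <= k)%N -> (S n)`_k = 0.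
  elim: n => [|n IH] nk; first by rewrite coef0.
  by rewrite /= coefD coefZ coefXn (gtn_eqF nk) mulr0 addr0 IH // ltnW.
have Slt n k : (k < n)%N -> (S n)`_k = a k.
  elim: n => // n IH; rewrite ltnS leq_eqVlt => /predU1P[->//|kn].
  by rewrite /= coefD coefZ coefXn (ltn_eqF kn) mulr0 addr0 IH.
have uS n : (u * S n.+1)`_n = (n == 0%N)%:R.
  rewrite /= mulrDr coefD -scalerAr coefZ coefMXn ltnn subnn.
  by rewrite mulrAC mulVf // mul1r addrC subrK.
exists (gs_of_seq a); apply: gsP => k; rewrite (gs_poly_mulE _ _ (leqnn _)) gs1E.
have [/natrP[n ->]|nk] := boolP (k \is a Num.nat); last first.
  rewrite big1 => [|e _].
    by case: eqVneq nk => // ->; rewrite nat_num0.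
  rewrite gs_of_seq_nnat ?mulr0 //; apply: contra nk => ke.
  by rewrite -(subrK e%:R k) rpredD // natr_nat.
rewrite pnatr_eq0 -uS coefM.
rewrite [RHS](eq_bigr (fun e : 'I_n.+1 => u`_e * a (n - e)%N)); last first.
  by move=> e _; rewrite Slt // ltnS leq_subr.
pose G e := if (e <= n)%N then u`_e * a (n - e)%N else 0.
transitivity (\sum_(e < size u + n.+1) G e).
  rewrite big_split_ord /= [X in _ = _ + X]big1 ?addr0.
    apply: eq_bigr => e _; rewrite /G; case: leqP => [en|ne].
      by congr (_ * _); rewrite -natrB //; apply: gs_of_seq_nat.
    rewrite (_ : gs_of_seq_coef a _ = 0) ?mulr0 //; apply/eqP; apply: contraT.
    move=> /(@gsupp_ge0 _ (gs_of_seq a)).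
    by rewrite subr_ge0 ler_nat leqNgt ne.
  by move=> e _; rewrite /G; case: ifP => // _; rewrite nth_default ?mul0r ?leq_addr.
rewrite addnC big_split_ord /= [X in _ + X]big1 ?addr0.
  by apply: eq_bigr => e _; rewrite /G -ltnS ltn_ord.
by move=> e _; rewrite /G ifF //; apply/negbTE; rewrite -ltnNge; exact: leq_addr.
Qed.

Lemma gs_Xn_mulE n y k : (gs_of_poly 'X^n * y) k = y (k - n%:R).
Proof.
rewrite (gs_poly_mulE _ _ (leqnn _)) size_polyXn big_ord_recr big1 /=.
  by rewrite coefXn eqxx mul1r add0r.
by move=> e _; rewrite coefXn ltn_eqF ?mul0r // ltn_ord.
Qed.

Lemma gs_Xn_inj n y z : gs_of_poly 'X^n * y = gs_of_poly 'X^n * z -> y = z.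
Proof.
move=> yz; apply: gsP => k; have := congr1 (fun t : genseries F => t (k + n%:R)) yz.
by rewrite !gs_Xn_mulE addrK.
Qed.

(** An exponent splits uniquely into an integer and a part in [0, 1), so the convolution has a
    single term. *)
Lemma gs_mul_nat_frac (y z : genseries F) (c : nat) (r : rat) :
  (forall i, y i != 0 -> i \is a Num.nat) -> (forall i, z i != 0 -> i < 1) ->
  0 <= r < 1 -> (y * z) (c%:R + r) = y c%:R * z r.
Proof.
move=> yN z1 /andP[r0 r1]; rewrite gsME -/(gs_conv _ _ _).
rewrite (@gs_convE _ _ _ _ [:: c%:R]) //.
  by rewrite big_seq1 [c%:R + r]addrC addrK.
move=> i yi zi; have /natrP[n nE] := yN i yi.
have := z1 _ zi; have := gsupp_ge0 zi; rewrite nE => H0 H1.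
rewrite inE eqr_nat eqn_leq.
by apply/andP; split; rewrite -ltnS -(ltr_nat rat) -natr1; lra.
Qed.

End GenSeriesFacts.

(** * Algebraic series *)

Section LinearDependence.

(** Completing W by a zero column gives a singular square matrix. *)
Lemma left_dependence (R : idomainType) n (W : 'M[R]_(n.+1, n)) :
  exists2 v : 'rV[R]_n.+1, v != 0 & v *m W = 0.
Proof.
pose A : 'M[R]_n.+1 := \matrix_(i, j) if unlift ord_max j is Some l then W i l else 0.
have /eqP/det0P[v v0 vA] : \det A = 0.
  rewrite (expand_det_col _ ord_max) big1 // => i _.
  by rewrite mxE unlift_none mul0r.
exists v => //; apply/rowP => l; rewrite [RHS]mxE.
have := congr1 (fun B : 'rV_n.+1 => B 0 (lift ord_max l)) vA; rewrite [in RHS]mxE => H.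
rewrite -[RHS]H !mxE; apply: eq_bigr => i _; by rewrite mxE liftK.
Qed.

(* The remainders of the 'X^(h k) modulo the polynomial P of x have bounded degree,
   so finitely many of them are dependent; R is not a field, hence pseudo-division. *)
Lemma algebraic_power_relation (R : idomainType) (K : comNzRingType)
    (f : {rmorphism R -> K}) (x : K) (h : nat -> nat) : ralgebraicOver f x ->
  exists (N : nat) (a : 'I_N -> R), (exists k, a k != 0)
    /\ \sum_k f (a k) * x ^+ h k = 0.
Proof.
move=> [P P0 rP]; pose n := (size P).-1.
have sP : size P = n.+1 by rewrite prednK // size_poly_gt0.
pose r k := 'X^(h k) %% P; pose s k := lead_coef P ^+ scalp 'X^(h k) P.
pose W : 'M[R]_(n.+1, n) := \matrix_(k, l) (r k)`_l.
have [v v0 vW] := left_dependence W.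
exists n.+1, (fun k => v 0 k * s k); split.
  have [k vk] : exists k, v 0 k != 0.
    apply/existsP; rewrite -negb_forall; apply: contra v0 => /forallP H.
    by apply/eqP/rowP => k; rewrite mxE; apply/eqP.
  by exists k; rewrite mulf_neq0 // expf_neq0 // lead_coef_eq0.
have xk k : f (s k) * x ^+ h k = (map_poly f (r k)).[x].
  have := congr1 (fun p => (map_poly f p).[x]) (Pdiv.Idomain.divp_eq 'X^(h k) P).
  rewrite map_polyZ map_polyXn rmorphD rmorphM /= hornerZ hornerXn hornerD hornerM.
  by rewrite (rootP rP) mulr0 add0r.
transitivity (\sum_k \sum_(l < n) f (v 0 k * (r k)`_l) * x ^+ l).
  apply: eq_bigr => k _; rewrite rmorphM -mulrA xk (@horner_coef_wide _ n).
    rewrite mulr_sumr; apply: eq_bigr => l _.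
    by rewrite coef_map rmorphM mulrA.
  rewrite (leq_trans (size_poly _ _)) //.
  by have := ltn_modp 'X^(h k) P; rewrite P0 sP ltnS.
rewrite exchange_big big1 //= => l _; rewrite -mulr_suml -rmorph_sum.
have := congr1 (fun B : 'rV_n => B 0 l) vW; rewrite !mxE => H.
rewrite (_ : \sum_i _ = 0) ?rmorph0 ?mul0r // -[RHS]H.
by apply: eq_bigr => i _; rewrite mxE.
Qed.

End LinearDependence.

Lemma well_ordered_preim (I : set rat) (h : rat -> rat) :
  {mono h : a b / a <= b} -> well_ordered I -> well_ordered (h @^-1` I).
Proof.
move=> hm wI A AI [a Aa].
have [||_ [b Ab <-] lb] := wI [set h b | b in A].
- by move=> _ [b Ab <-]; apply: AI.
- by exists (h a), a.
by exists b => // c Ac; rewrite -hm; apply: lb; exists c.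
Qed.

Lemma card_finField_pchar (F : finFieldType) p : p \in [pchar F] ->
  exists2 m, (0 < m)%N & #|F| = (p ^ m)%N.
Proof.
move=> pF; exists (logn p #|F|); last exact: (card_pprimeChar pF).
rewrite lt0n; apply/negP => /eqP l0.
have := card_pprimeChar pF; rewrite [#|_|](_ : _ = #|F|) // l0 => F1.
by have := finNzRing_gt1 F; rewrite F1.
Qed.

Lemma sum_option (V : nmodType) (I : finType) (f : option I -> V) :
  \sum_k f k = f None + \sum_k f (Some k).
Proof.
rewrite (bigD1 None) //= (reindex_omap Some id) /=; last by case.
by congr (_ + _); apply: eq_bigl => k; rewrite eqxx.
Qed.

(** * Algebraic series are regular *)

Section AlgebraicRegular.
Variables (F : finFieldType) (p m : nat).
Hypotheses (pF : p \in [pchar F]) (m_gt0 : (0 < m)%N) (cardF : #|F| = (p ^ m)%N).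
Local Notation q := (p ^ m)%N.

Let p_gt1 : (1 < p)%N.
Proof. exact/prime_gt1/(pcharf_prime pF). Qed.

Lemma expf_cardX (a : F) k : a ^+ (q ^ k) = a.
Proof.
elim: k => [|k IH]; first by rewrite expr1.
by rewrite expnS exprM -{1}cardF expf_card.
Qed.

Lemma gs_expqE (x : genseries F) k i : (x ^+ (q ^ k)) i = x (i / p%:R ^+ (m * k)).
Proof. by rewrite -expnM gs_frobeniusE // natrX expnM expf_cardX. Qed.

(** A nonzero polynomial is a power of 'X, which acts as a shift, times a polynomial invertible in
    F[[t]]. *)
Lemma gs_poly_regular (a : {poly F}) (z : genseries F) : a != 0 ->
  gs_of_poly a * z = 0 -> z = 0.
Proof.
move=> a0; have [v [u /implyP/(_ a0) u0 ->]] := multiplicity_XsubC a 0.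
rewrite subr0 rmorphM /= => H.
have [s us] : exists s, gs_of_poly u * s = 1.
  by apply: gs_poly_inv; rewrite -horner_coef0.
apply: (@gs_Xn_inj _ v); rewrite mulr0.
by rewrite -[LHS]mul1r -us mulrAC !mulrA -[RHS](mulr0 s) -H; ring.
Qed.

Lemma gs_poly_div (a : {poly F}) (x : genseries F) : a != 0 ->
  exists v (z : genseries F), gs_of_poly 'X^v * x = gs_of_poly a * z.
Proof.
move=> a0; have [v [u /implyP/(_ a0) u0 ->]] := multiplicity_XsubC a 0.
have [s us] : exists s, gs_of_poly u * s = 1.
  by apply: gs_poly_inv; rewrite -horner_coef0.
exists v, (s * x); rewrite subr0 rmorphM /=.
by rewrite -[X in _ * X]mul1r -us; ring.
Qed.

(* With 'X^v x = a_0 z, the relation gives Y = sum_(j > 0) B_j Y^(q^j) for z = t^v Y,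
   where the factor a_0^2 has been cancelled; the powers of 'X only compensate for the
   negative exponents of Y. *)
Lemma contraction_regular (x : genseries F) (N : nat) (a : nat -> {poly F}) :
  a 0%N != 0 -> \sum_(j < N.+1) gs_of_poly (a j) * x ^+ (q ^ j) = 0 -> regular p x.
Proof.
move=> a0 relx; have [v [z zE]] := gs_poly_div x a0.
have q1 : (1 < q)%N by rewrite -(expn0 p) ltn_exp2l.
(* The relation is multiplied by 'X^(v q^N). Each x^(q^j) absorbs 'X^(v q^j) to become (a_0
   z)^(q^j), and [T j] is the factor left over. *)
pose T j := gs_of_poly ('X^(v * (q ^ N - q ^ j)) : {poly F}).
pose B j := - (a j * a 0%N ^+ (q ^ j - 2)).
have qj2 j : (2 <= q ^ j.+1)%N.
  by rewrite (leq_trans q1) // -{1}(expn1 q) leq_exp2l.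
have relz : T 0%N * z = \sum_(j < N) gs_of_poly (B j.+1) * (T j.+1 * z ^+ (q ^ j.+1)).
  apply/eqP; rewrite -subr_eq0; apply/eqP; apply: (@gs_poly_regular (a 0%N ^+ 2)).
    by rewrite expf_neq0.
  have: gs_of_poly 'X^(v * q ^ N) * (\sum_(j < N.+1) gs_of_poly (a j) * x ^+ (q ^ j)) = 0.
    by rewrite relx mulr0.
  rewrite mulr_sumr (eq_bigr (fun j : 'I_N.+1 => gs_of_poly (a j * a 0%N ^+ (q ^ j)) *
      (T j * z ^+ (q ^ j)))); last first.
    move=> j _; have jN : (q ^ j <= q ^ N)%N by rewrite leq_exp2l // -ltnS.
    have -> : gs_of_poly 'X^(v * q ^ N) = T j * gs_of_poly ('X^v : {poly F}) ^+ (q ^ j).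
      by rewrite -rmorphXn -rmorphM -exprM -exprD -mulnDr subnK.
    rewrite mulrCA -!mulrA -exprMn zE exprMn rmorphM rmorphXn /=; ring.
  rewrite big_ord_recl expn0 expr1 => H; rewrite -[RHS]H {H}.
  rewrite mulrBr mulr_sumr; congr (_ + _).
  rewrite -sumrN; apply: eq_bigr => j _; rewrite lift0.
  rewrite -{2}(subnK (qj2 j)) exprD /B rmorphN !rmorphM /=; ring.
pose Y i := z (i + v%:R).
pose s := (\max_(j < N) size (B j.+1))%N.
have sB (j : 'I_N) : (size (B j.+1) <= s)%N.
  exact: (leq_bigmax (F := fun j : 'I_N => size (B j.+1))).
have relY i : Y i = \sum_(k : 'I_N * 'I_s) (B k.1.+1)`_k.2 *
    Y ((i - k.2%:R) / p%:R ^+ (m * k.1.+1)).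
  have := congr1 (fun t : genseries F => t (i + (v * q ^ N)%:R)) relz.
  rewrite gs_Xn_mulE => H.
  rewrite -(pair_big xpredT xpredT (fun (j : 'I_N) (e : 'I_s) => (B j.+1)`_e *
    Y ((i - e%:R) / p%:R ^+ (m * j.+1)))) /=.
  transitivity (z (i + (v * q ^ N)%:R - (v * (q ^ N - q ^ 0))%:R)).
    congr (z _); rewrite expn0 mulnBr muln1 natrB; first by ring.
    by rewrite leq_pmulr // expn_gt0 ltnW.
  rewrite H (big_morph (fun t : genseries F => t _) (fun _ _ => erefl)
    (erefl : (0 : genseries F) _ = 0)).
  apply: eq_bigr => j _; rewrite (gs_poly_mulE _ _ (sB j)).
  apply: eq_bigr => e _; rewrite gs_Xn_mulE gs_expqE; congr (_ * z _).
  have jN : (q ^ j.+1 <= q ^ N)%N by rewrite leq_exp2l.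
  rewrite mulnBr natrB ?leq_mul2l ?jN ?orbT // [(v * q ^ j.+1)%N in LHS]mulnC.
  have -> : (q ^ j.+1)%N = (p ^ (m * j.+1))%N by rewrite expnM.
  have -> : (p ^ (m * j.+1) * v)%:R = p%:R ^+ (m * j.+1) * v%:R :> rat.
    by rewrite natrM natrX.
  by have := pX_neq0 p_gt1 (m * j.+1) => ?; field.
have woY : well_ordered [set i | Y i != 0].
  apply: (@well_ordered_preim (gsupp z) (fun i => i + v%:R)); last exact: gsupp_wo.
  by move=> b c; rewrite lerD2r.
have gY : good p Y.
  apply: (@good_solution F p p_gt1 (option ('I_N * 'I_s))
    (fun k => if k is Some k then (B k.1.+1)`_k.2 else -1)
    (fun k => if k is Some k then k.2 : nat else 0%N)
    (fun k => if k is Some k then m * k.1.+1 else 0)%N) => //.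
  - move=> [[j e]|] [[j' e']|] //= _ _ => [/eqP|/eqP|/esym/eqP].
    + by rewrite eqn_pmul2l // eqSS => /eqP/val_inj -> /val_inj ->.
    + by rewrite muln_eq0 gtn_eqF.
    + by rewrite muln_eq0 gtn_eqF.
  - by exists None; rewrite oppr_eq0 oner_eq0.
  - move=> i; rewrite sum_option /= expr0 divr1 subr0 mulN1r addrC.
    by apply/eqP; rewrite subr_eq0 -relY.
have mj (k : 'I_N * 'I_s) : (0 < m * k.1.+1)%N by rewrite muln_gt0 m_gt0.
have := @regular_contraction F p p_gt1 _ _ _ _ Y (size (a 0%N))
  (fun t => (a 0%N)`_t) mj relY gY.
congr regular; apply: funext => i.
have := congr1 (fun t : genseries F => t (i + v%:R)) zE.
rewrite gs_Xn_mulE addrK (gs_poly_mulE _ _ (leqnn _)) => ->.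
by apply: eq_bigr => t _; rewrite /Y addrAC.
Qed.

(** With d the lowest index of a nonzero coefficient, y = x^(q^d) satisfies a relation with nonzero
    coefficient at y itself, and x is recovered as y(q^d i). *)
Lemma algebraic_regular (x : genseries F) :
  ralgebraicOver (@gs_of_poly F) x -> regular p x.
Proof.
move=> /(algebraic_power_relation (fun k => q ^ k)%N)[N [b [[k0 bk0] relx]]].
pose a j := if insub j is Some k then b k else 0.
have aE (k : 'I_N) : a k = b k by rewrite /a valK.
have ex_a : exists j, (a j != 0) && (j < N)%N by exists k0; rewrite aE bk0 ltn_ord.
case: (ex_minnP ex_a) => d /andP[ad dN] dmin.
have {}relx : \sum_(j < N) gs_of_poly (a j) * x ^+ (q ^ j) = 0.
  by rewrite -[RHS]relx; apply: eq_bigr => k _; rewrite aE.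
have NE : N = (d + (N - d.+1).+1)%N by lia.
move: relx; rewrite NE big_split_ord /= big1 ?add0r; last first.
  move=> k _; suff -> : a k = 0 by rewrite rmorph0 mul0r.
  apply/eqP; apply: contraT => ak; have := dmin k.
  by rewrite ak (ltn_trans (ltn_ord k) dN) => /(_ isT); rewrite leqNgt ltn_ord.
move=> relx.
have : regular p (x ^+ (q ^ d)).
  apply: (@contraction_regular _ (N - d.+1) (fun j => a (d + j)%N)); first by rewrite addn0.
  by rewrite -[RHS]relx; apply: eq_bigr => j _; rewrite -exprM -expnD.
move=> /(regular_scaleX p_gt1 (m * d)); congr regular; apply: funext => i.
by rewrite gs_expqE [_ * i]mulrC mulfK // pX_neq0.
Qed.

End AlgebraicRegular.

(** * Regular series are algebraic *)

Section RegularAlgebraic.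
Variables (F : finFieldType) (p m : nat).
Hypotheses (pF : p \in [pchar F]) (m_gt0 : (0 < m)%N) (cardF : #|F| = (p ^ m)%N).
Local Notation q := (p ^ m)%N.

Let p_gt1 : (1 < p)%N.
Proof. exact/prime_gt1/(pcharf_prime pF). Qed.

(** More powers than generators force a dependence; since q > 1 the degrees q^j are distinct, so the
    resulting polynomial is nonzero. *)
Lemma dependent_powers_algebraic (K : finType) (E : K -> genseries F) (x : genseries F) :
  (forall j, (j <= #|K|)%N -> exists w : K -> {poly F},
     x ^+ (q ^ j) = \sum_k gs_of_poly (w k) * E k) ->
  ralgebraicOver (@gs_of_poly F) x.
Proof.
move=> xE.
have xE' (j : 'I_#|K|.+1) : exists w : K -> {poly F},
    x ^+ (q ^ j) = \sum_k gs_of_poly (w k) * E k by apply: xE; rewrite -ltnS.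
have [w wP] := choice xE'.
pose W : 'M[{poly F}]_(#|K|.+1, #|K|) := \matrix_(j, l) w j (enum_val l).
have [v v0 vW] := left_dependence W.
have q1 : (1 < q)%N by rewrite -(expn0 p) ltn_exp2l.
exists (\sum_j v 0 j *: 'X^(q ^ j)).
  apply: contra_neq v0 => P0; apply/rowP => j; rewrite mxE.
  have := congr1 (fun P : {poly {poly F}} => P`_(q ^ j)) P0.
  rewrite coef0 coef_sum (bigD1 j) //= big1 => [|l lj].
    by rewrite coefZ coefXn eqxx mulr1 addr0.
  by rewrite coefZ coefXn eqn_exp2l // eq_sym val_eqE (negPf lj) mulr0.
rewrite /root rmorph_sum /= horner_sum; apply/eqP.
transitivity (\sum_j \sum_k gs_of_poly (v 0 j * w j k) * E k).
  apply: eq_bigr => j _; rewrite map_polyZ map_polyXn hornerZ hornerXn wP mulr_sumr.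
  by apply: eq_bigr => k _; rewrite rmorphM mulrA.
rewrite exchange_big big1 //= => k _; rewrite -mulr_suml -rmorph_sum /=.
have := congr1 (fun B : 'rV_#|K| => B 0 (enum_rank k)) vW; rewrite !mxE => H.
rewrite (_ : \sum_j _ = 0) ?rmorph0 ?mul0r // -[RHS]H.
by apply: eq_bigr => j _; rewrite mxE enum_rankK.
Qed.

Lemma Zinvp_frac_val z : Zinvp p z -> 0 <= z < 1 -> exists fs : seq 'I_p, z = frac_val fs.
Proof.
move=> [a [k ->]]; rewrite pmulr_lge0 ?invr_gt0 ?pX_gt0 // ler0z.
rewrite ltr_pdivrMr ?pX_gt0 // mul1r => /andP[].
case: a => // a _; rewrite -[_%:~R]/(a%:R) -natrX ltr_nat => /(digits_val_ex p_gt1)[fs sz <-].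
by exists fs; rewrite frac_valE // sz natrX.
Qed.

Lemma Zinvp_affine c l z : Zinvp p ((c%:R + z) / p%:R ^+ l) -> Zinvp p z.
Proof.
move=> [a [k H]]; exists (a * (p ^ l)%N - c%:Z * (p ^ k)%N), k.
rewrite rmorphB !rmorphM /= -[(p ^ l)%N%:~R]/((p ^ l)%:R) -[(p ^ k)%N%:~R]/((p ^ k)%:R) !natrX.
have pl := pX_neq0 p_gt1 l; have pk := pX_neq0 p_gt1 k.
have -> : z = (c%:R + z) / p%:R ^+ l * p%:R ^+ l - c%:R by field.
rewrite H -[c%:~R]/(c%:R); field; exact: pk.
Qed.

Lemma gs_window (x : genseries F) c l : exists g : genseries F, forall z,
  g z = if 0 <= z < 1 then x ((c%:R + z) / p%:R ^+ l) else 0.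
Proof.
pose g z := if 0 <= z < 1 then x ((c%:R + z) / p%:R ^+ l) else 0.
suff Pg : gs_pred g by exists (GenSeries Pg).
apply/asboolP; split=> [z|]; first by rewrite /= /g; case: ifP => [/andP[]//|]; rewrite eqxx.
apply: (@well_orderedS ((fun z => (c%:R + z) / p%:R ^+ l) @^-1` gsupp x)).
  by move=> z; rewrite /= /g; case: ifP; rewrite ?eqxx.
apply: well_ordered_preim; last exact: gsupp_wo.
by move=> a b; rewrite ler_pM2r ?invr_gt0 ?pX_gt0 // lerD2l.
Qed.

Lemma regular_algebraic (x : genseries F) : gsupp x `<=` Zinvp p ->
  regular p x -> ralgebraicOver (@gs_of_poly F) x.
Proof.
move=> hx [S [s0 [step [out [/recognizable_family[n [A [w [v vP]]]] xE]]]]].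
have xNZ i : ~ Zinvp p i -> x i = 0 by move=> ni; apply: gsuppN => /hx.
have digs_ex c : exists ds : seq 'I_p, digits_val ds = c.
  by have [ds _ dsc] := int_part_ex p_gt1 c; exists ds.
have [digs digsP] := choice digs_ex.
pose st c := foldl step s0 (digs c).
pose act (u : 'rV[F]_n) es := foldl (fun u d => u *m A d) u es.
have actE es u fs : act u es *m word_mulmx A w fs = u *m word_mulmx A w (es ++ fs).
  by elim: es u => //= d es IH u; rewrite IH mulmxA.
(* All pairs (c, l) that lead to u share one window: x vanishes off Z[1/p], and there each z in [0,
   1) has a finite expansion, read by u. Vectors without such a pair get the series 0. *)
have window_ex (u : 'rV[F]_n) : exists g : genseries F,
    (forall z, g z != 0 -> z < 1) /\ forall c l,
    (forall fs, (u *m word_mulmx A w fs) 0 0 = x ((c%:R + frac_val fs) / p%:R ^+ l)) ->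
    forall z, 0 <= z < 1 -> g z = x ((c%:R + z) / p%:R ^+ l).
  have [[c [l H]]|nH] := pselect (exists c l, forall fs,
      (u *m word_mulmx A w fs) 0 0 = x ((c%:R + frac_val fs) / p%:R ^+ l)); last first.
    by exists 0; split=> [z|c l H]; [rewrite eqxx|case: nH; exists c, l].
  have [h hE] := gs_window x c l; exists h; split.
    by move=> z; rewrite hE; case: ifP => [/andP[]//|]; rewrite eqxx.
  move=> c' l' H' z z01; rewrite hE z01.
  have [/Zinvp_frac_val/(_ z01)[fs ->]|nz] := pselect (Zinvp p z).
    by rewrite -H -H'.
  by rewrite !xNZ // => /Zinvp_affine.
have [g gP] := choice window_ex.
pose K : finType := (S * 'rV[F]_n)%type.
(* With m #|K| digits, r is long enough to place the point before its last m j digits for every j <=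
   #|K|. *)
pose k := (m * #|K|)%N; pose Q := (p ^ k)%N.
have Q0 : (0 < Q)%N by rewrite expn_gt0 ltnW.
(* For i = Q a + r + z with r < Q and 0 <= z < 1, the coefficient of x^(q^j) at i
   depends only on r, on the state reached by a, and on z through the vector obtained
   by reading the digits of r with the radix point before the last m j of them. *)
pose h s := gs_of_seq (fun N => ((Q %| N) && (st (N %/ Q) == s))%N%:R : F).
pose E (kk : K) := h kk.1 * g kk.2.
apply: (@dependent_powers_algebraic K E) => j jK.
pose V s (rs : seq 'I_p) :=
  act (v (foldl step s (take (k - m * j) rs))) (drop (k - m * j) rs).
exists (fun kk => \sum_(rs : k.-tuple 'I_p | kk.2 == V kk.1 rs) 'X^(digits_val rs)).
apply: gsP => i; rewrite gs_expqE //.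
have gs_sumE (J : finType) (P : pred J) (f : J -> genseries F) t :
    (\sum_(r | P r) f r) t = \sum_(r | P r) f r t.
  exact: (big_morph (fun y : genseries F => y t)).
rewrite gs_sumE.
transitivity (\sum_(s : S) \sum_(rs : k.-tuple 'I_p)
  E (s, V s rs) (i - (digits_val rs)%:R)); last first.
  transitivity (\sum_(s : S) \sum_(u : 'rV[F]_n) (gs_of_poly
    (\sum_(rs : k.-tuple 'I_p | u == V s rs) 'X^(digits_val rs)) * E (s, u)) i); last first.
    by rewrite pair_big; apply: eq_bigr => -[s u] _.
  apply: eq_bigr => s _.
  rewrite [RHS](eq_bigr (fun u => \sum_(rs : k.-tuple 'I_p | u == V s rs)
    E (s, u) (i - (digits_val rs)%:R))); last first.
    move=> u _; rewrite rmorph_sum mulr_suml gs_sumE; apply: eq_bigr => rs _.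
    exact: gs_Xn_mulE.
  rewrite (exchange_big_dep xpredT) //=; apply: eq_bigr => rs _.
  by rewrite (big_pred1 (V s rs)) // => u; rewrite eq_sym.
have g0 (y : genseries F) t : t < 0 -> y t = 0.
  by move=> t0; apply: gsuppN => /gsupp_ge0; rewrite leNgt t0.
have [i0|i0] := ltP i 0.
  rewrite g0 ?pmulr_llt0 ?invr_gt0 ?pX_gt0 // big1 // => s _; rewrite big1 // => rs _.
  by rewrite g0 // subr_lt0 (lt_le_trans i0) ?ler0n.
pose c0 := Num.truncn i; pose z := i - c0%:R.
have /andP[ci ic] := truncn_itv i0.
have z01 : 0 <= z < 1 by rewrite /z -/c0 -natr1 in ic *; apply/andP; split; lra.
have iE : i = c0%:R + z by rewrite /z addrC subrK.
pose a := (c0 %/ Q)%N.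
have [rs0' sz0 rs0E] := digits_val_ex p_gt1 (ltn_pmod c0 Q0).
have /eqP sz0' := sz0; pose rs0 := Tuple sz0'.
have hE s N : h s N%:R = ((Q %| N) && (st (N %/ Q) == s))%N%:R.
  exact: gs_of_seq_nat.
have EE s u N : E (s, u) (N%:R + z) = ((Q %| N) && (st (N %/ Q) == s))%N%:R * g u z.
  rewrite -hE; apply: gs_mul_nat_frac => // t; last by case: (gP u) => gt _; apply: gt.
  by apply: contraNT => /gs_of_seq_nnat ->.
(* The factor [h s] forces Q to divide the integer part of the exponent, which leaves only the
   remainder [rs0] of c0 and the state of a. *)
have term s (rs : k.-tuple 'I_p) : E (s, V s rs) (i - (digits_val rs)%:R)
    = if (s == st a) && (rs == rs0) then g (V (st a) rs0) z else 0.
  have [lt|le] := ltnP c0 (digits_val rs).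
    rewrite g0; last first.
      move: lt z01; rewrite -(ler_nat rat) -natr1 iE => lt /andP[z0 z1]; lra.
    case: eqP => //= _; case: eqP => // rsE; move: lt.
    by rewrite rsE /= rs0E ltnNge leq_mod.
  rewrite iE addrAC -natrB // EE.
  have rsQ : (digits_val rs < Q)%N by have := digits_val_lt rs; rewrite size_tuple.
  have -> : (Q %| c0 - digits_val rs)%N = (rs == rs0).
    rewrite -eqn_mod_dvd // (modn_small rsQ); apply/eqP/eqP => [e|->]; last by rewrite /= rs0E.
    apply: val_inj; apply: (digits_val_inj (p := p)); first by rewrite size_tuple sz0.
    by rewrite -e rs0E.
  case: (eqVneq rs rs0) => [->|_]; last by rewrite andbF mul0r.
  rewrite andbT /= rs0E.
  have -> : ((c0 - c0 %% Q) %/ Q)%N = a.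
    by rewrite {1}(divn_eq c0 Q) addnK mulnK.
  by rewrite eq_sym; case: eqP => [->|_]; rewrite ?mul1r ?mul0r.
rewrite (eq_bigr (fun s => \sum_(rs : k.-tuple 'I_p)
    if (s == st a) && (rs == rs0) then g (V (st a) rs0) z else 0)); last first.
  by move=> s _; apply: eq_bigr => rs _; apply: term.
rewrite (bigD1 (st a)) //= [X in _ + X]big1 ?addr0 => [|s /negPf sa]; last first.
  by rewrite big1 // => rs _; rewrite sa.
rewrite (bigD1 rs0) //= [X in _ + X]big1 ?addr0 => [|rs /negPf rsa]; last first.
  by rewrite rsa andbF.
rewrite !eqxx /= iE; have [_ gE] := gP (V (st a) rs0); rewrite (gE c0 (m * j)%N) // => fs.
rewrite /V actE -vP -foldl_cat -xE.
have mjk : (m * j <= k)%N by rewrite leq_mul2l jK orbT.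
rewrite -shift_radix // -catA cat_take_drop digits_val_cat digsP size_tuple size_drop.
by rewrite size_tuple subKn //= rs0E -divn_eq.
Qed.

End RegularAlgebraic.

Theorem theorem1 (F : finFieldType) (p : nat) (hp : p \in [pchar F])
    (x : genseries F) (hx : gsupp x `<=` Zinvp p) :
  ralgebraicOver (@gs_of_poly F) x <-> automatic p x.
Proof.
have p_gt1 : (1 < p)%N := prime_gt1 (pcharf_prime hp).
have [m m_gt0 cardF] := card_finField_pchar hp.
split=> [/(algebraic_regular hp m_gt0 cardF)|/(automatic_regular p_gt1)].
  exact: regular_automatic.
exact: (regular_algebraic hp m_gt0 cardF hx).
Qed.
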